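(* Let $\mathcal{X}_{(n)} = (\mathcal{X}_{(n)}, P_{(n)}, \pi_{(n)})$, $n \ge 1$, be a sequence of finite irreducible Markov chains with non-negative Bakry--Émery curvature, i.e. $\mathrm{BE}(\mathcal{X}_{(n)}, P_{(n)}) \ge 0$ for every $n$. Assume that for every $\varepsilon \in (0,1/2)$, $$\lim_{n \to \infty} \frac{k_n^{2}\,(1+\log \Delta_n)\,t_{\mathrm{rel}}^{(n)}}{\sqrt{t_{\mathrm{mix}}^{(n)}(1-\varepsilon)}} = 0.$$ Then a cutoff occurs for $(\mathcal{X}_{(n)})_n$, that is, for every $\varepsilon \in (0,1)$, $$\lim_{n\to\infty} \frac{t_{\mathrm{mix}}^{(n)}(\varepsilon)}{t_{\mathrm{mix}}^{(n)}(1-\varepsilon)} = 1.$$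
   Context: A finite irreducible Markov chain $(\mathcal{X},P)$ (also written $(\mathcal{X},P,\pi)$) consists of a finite set $\mathcal{X}$ with $|\mathcal{X}|\ge 2$ and an irreducible stochastic matrix $P$ on $\mathcal{X}$; $\pi$ is its stationary distribution. Neither reversibility nor symmetry of the support of $P$ is assumed. Continuous-time semigroup: $\mathscr{P}_t(x,y) = e^{-t}\sum_{m\ge 0} \frac{t^m}{m!} P^m(x,y)$, $t\ge 0$. Total variation: $\|\mu_1-\mu_2\|_{\mathrm{TV}} = \frac12\sum_{x}|\mu_1(x)-\mu_2(x)|$. Mixing time: $t_{\mathrm{mix}}(\varepsilon) = \inf\{t\ge 0 : \max_{x}\|\mathscr{P}_t(x,\cdot)-\pi\|_{\mathrm{TV}}\le\varepsilon\}$, $0<\varepsilon<1$. For $f,g:\mathcal{X}\to\mathbb{R}$: $\Gamma(f,g)(x)=\frac12\sum_{y}(f(x)-f(y))(g(x)-g(y))P(x,y)$, $\Gamma(f)=\Gamma(f,f)$, $\mathcal{E}(f)=\sum_x \Gamma(f)(x)\pi(x)$, $\mathrm{Var}_\pi(f)=\sum_x (f(x)-\mathbb{E}_\pi[f])^2\pi(x)$ with $\mathbb{E}_\pi[f]=\sum_x f(x)\pi(x)$. Relaxation time: $t_{\mathrm{rel}}=\sup\{\mathrm{Var}_\pi(f)/\mathcal{E}(f) : f:\mathcal{X}\to\mathbb{R},\ \mathcal{E}(f)>0\}$. $\Delta(P)=\max\{1/P(x,y) : P(x,y)>0,\ x\ne y\}$. Directed distance: $d_P(x\to y)=\min\{k\in\mathbb{N}_0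 : P^k(x,y)>0\}$ (with $P^0=I$). $k_{(\mathcal{X},P)}=\max\{d_P(y\to x) : d_P(x\to y)=1\}$. Laplacian: $\mathcal{L}f(x)=\sum_y P(x,y)(f(y)-f(x))$. The Bakry--Émery curvature $\mathrm{BE}(\mathcal{X},P)$ is the supremum of all $\kappa$ such that $\frac12\mathcal{L}\Gamma(f)(x)\ge\Gamma(f,\mathcal{L}f)(x)+\kappa\,\Gamma(f)(x)$ for every $f:\mathcal{X}\to\mathbb{R}$ and $x\in\mathcal{X}$. For the $n$-th chain, $t_{\mathrm{mix}}^{(n)}(\cdot)$, $t_{\mathrm{rel}}^{(n)}$ are the mixing and relaxation times of $(\mathcal{X}_{(n)},P_{(n)})$, $k_n=k_{(\mathcal{X}_{(n)},P_{(n)})}$, $\Delta_n=\Delta(P_{(n)})$. A quotient with positive numerator and zero denominator is read as $+\infty$ (so the assumed limit includes $t_{\mathrm{mix}}^{(n)}(1-\varepsilon)>0$ for all large $n$). *)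

(* Defs.v *)
From HB Require Import structures.
From mathcomp Require Import all_boot all_order all_algebra.
From mathcomp Require Import all_classical all_reals all_analysis.

Set Implicit Arguments.
Unset Strict Implicit.
Unset Printing Implicit Defensive.

Import Order.TTheory GRing.Theory Num.Theory.
Import numFieldNormedType.Exports.

Local Open Scope classical_set_scope.
Local Open Scope ring_scope.

(* P^m(x, y), with P^0 the identity *)
Fixpoint kpow (R : realType) (X : finType) (P : X -> X -> R) (m : nat)
    (x y : X) : R :=
  if m is m'.+1 then \sum_(z : X) P x z * kpow P m' z y else (x == y)%:R.

(* By irreducibility [stat] is the unique stationary distribution. *)
Record markov_chain (R : realType) := MarkovChain {
  state :> finType;
  trans : state -> state -> R;
  stat : state -> R;
  card_state : (2 <= #|state|)%N;
  trans_ge0 : forall x y, 0 <= trans x y;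
  trans_sum1 : forall x, \sum_(y : state) trans x y = 1;
  trans_irreducible : forall x y, exists m, 0 < kpow trans m x y;
  stat_ge0 : forall x, 0 <= stat x;
  stat_sum1 : \sum_(x : state) stat x = 1;
  stat_invariant : forall y, \sum_(x : state) stat x * trans x y = stat y }.

Section MarkovChain.
Variables (R : realType) (X : markov_chain R).
Implicit Types (f g : X -> R) (x y : X).

Definition semigroup (t : R) x y : R :=
  expR (- t) *
  limn (series (fun m : nat => t ^+ m / m`!%:R * kpow (@trans R X) m x y)).

Definition tv_dist (mu1 mu2 : X -> R) : R :=
  2^-1 * \sum_(x : X) `|mu1 x - mu2 x|.

(* The terms are nonnegative and X is nonempty, so the default value 0 of the
   maximum plays no role. *)
Definition worst_tv (t : R) : R :=
  \big[Num.max/0]_(x : X) tv_dist (semigroup t x) (@stat R X).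

(* For 0 < eps the set is nonempty (convergence to equilibrium) and bounded
   below, so that the real-valued infimum is the intended one. *)
Definition tmix (eps : R) : R := inf [set t | 0 <= t /\ worst_tv t <= eps].

Definition Gamma f g x : R :=
  2^-1 * \sum_(y : X) (f x - f y) * (g x - g y) * trans x y.

Definition dirichlet f : R := \sum_(x : X) Gamma f f x * stat x.

Definition mean f : R := \sum_(x : X) f x * stat x.

Definition variance f : R := \sum_(x : X) (f x - mean f) ^+ 2 * stat x.

(* The set is nonempty and bounded above by irreducibility and 2 <= #|X|. *)
Definition trel : R :=
  sup [set r | exists f, 0 < dirichlet f /\ r = variance f / dirichlet f].

(* The index set is nonempty, by irreducibility and 2 <= #|X|. *)
Definition Delta : R :=
  \big[Num.max/0]_(p : X * X | (0 < trans p.1 p.2) && (p.1 != p.2))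
    (trans p.1 p.2)^-1.

Definition ddist x y : nat := ex_minn (trans_irreducible x y).

Definition kmax : nat :=
  \max_(p : X * X | ddist p.1 p.2 == 1%N) ddist p.2 p.1.

Definition laplacian f x : R := \sum_(y : X) trans x y * (f y - f x).

Definition BE_inequality (kappa : R) : Prop := forall f x,
  2^-1 * laplacian (Gamma f f) x >=
  Gamma f (laplacian f) x + kappa * Gamma f f x.

Definition BE : \bar R :=
  ereal_sup [set kappa%:E | kappa in [set kappa | BE_inequality kappa]].

End MarkovChain.

(* In \bar R one has 0^-1 = +oo, hence a / 0 = +oo for a > 0 (this fails for
   the division of R). *)
Definition equot (R : realType) (a b : R) : \bar R := (a%:E / b%:E)%E.

Definition cutoff (R : realType) (X : nat -> markov_chain R) : Prop :=
  forall eps : R, 0 < eps < 1 ->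
    equot (tmix (X n) eps) (tmix (X n) (1 - eps)) @[n --> \oo] --> 1%E.

(* Main.v *)
Require Import Defs.
From HB Require Import structures.
From mathcomp Require Import all_boot all_order all_algebra.
From mathcomp Require Import all_classical all_reals all_analysis.
From mathcomp Require Import ring lra.
Import Order.TTheory GRing.Theory Num.Theory.
Import numFieldNormedType.Exports.
Local Open Scope classical_set_scope.
Local Open Scope ring_scope.

(** Let [p_t] be the semigroup, [f = p_t(o, .) / pi] the density at time [t] and
    [q = k^2 (1 + ln Delta) t_rel].  Take [t] with worst-case distance at most
    [1 - eps].  Nonnegative curvature gives the local Poincare inequality
    [Var_{p_t(o, .)}(g) <= 2 t max Gamma(g)], which is applied to [g = ln f].
    The gradient of [ln f] along an edge is [O(k^2 (1 + ln Delta))]: shifting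
    Poisson weights compares [p_t(o, x)] and [p_t(o, y)] when [y -> x] is an
    edge, up to a factor controlled by [ln (1 / p_t(o, y)) / t], hence by
    [diameter / t], and an edge is traversed backwards in at most [k] steps.
    The diameter is [O(k t)] because the distance to [o] is at most of order [t]
    under [p_t(o, .)], is concentrated under [pi] by the Poincare inequality,
    and these two laws overlap.  So the varentropy of [p_t(o, .)] is
    [O(t k^4 (1 + ln Delta)^2)]; by Chebyshev's inequality and the overlap, up
    to mass [eps / 2] the density [f] is bounded by [exp (O(sqrt t k^2 (1 + ln
    Delta)))], and [L^2] contraction at rate [1 / t_rel] mixes after a further
    time [O(q sqrt t)], which is [o(t)] by assumption. *)

Set Implicit Arguments.
Unset Strict Implicit.
Unset Printing Implicit Defensive.

(** * Exponential generating functions of sequences with values in [[0, 1]] *)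

Section ExpGeneratingFunction.
Variable R : realType.
Implicit Types (a b : nat -> R) (t : R).

(** For [t >= 0], [expR (- t) * egf a t] is the mean of [a] under the Poisson law of parameter [t];
    the semigroup is the case where [a] lists the kernel powers. *)
Definition egf a t : R := limn (series (fun m => t ^+ m / m`!%:R * a m)).

Lemma cvg_egf a t : (forall m, 0 <= a m <= 1) ->
  series (fun m => t ^+ m / m`!%:R * a m) @ \oo --> egf a t.
Proof.
move=> a01; apply: normed_cvg.
apply: (@series_le_cvg _ _ (fun n => exp_coeff `|t| n)) => [m|m|m|].
- exact: normr_ge0.
- by rewrite /exp_coeff /= divr_ge0// exprn_ge0.
- have /andP[a0 a1] := a01 m.
  rewrite /exp_coeff /= !normrM normfV normrX !(ger0_norm a0) (ger0_norm (ler0n _ _)).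
  by rewrite ler_piMr// divr_ge0// exprn_ge0.
- exact: is_cvg_series_exp_coeff.
Qed.

Lemma egf_pseries a :
  egf a = fun t => limn (pseries (fun m => a m / m`!%:R) t).
Proof.
apply/funext => t; rewrite /egf /pseries; congr (limn (series _)).
by apply/funext => m /=; rewrite mulrC mulrA mulrAC.
Qed.

Lemma pseries_diffs_fact a :
  pseries_diffs (fun m => a m / m`!%:R) = fun m => a m.+1 / m`!%:R.
Proof.
apply/funext => m; rewrite /pseries_diffs factS natrM invfM mulrCA.
by rewrite mulVKf.
Qed.

(** Termwise differentiation shifts the sequence; the series of [a] and of its first two shifts all
    converge at [|t| + 1], strictly beyond [|t|]. *)
Lemma is_derive_egf a t : (forall m, 0 <= a m <= 1) ->
  is_derive t 1 (egf a) (egf (fun m => a m.+1) t).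
Proof.
move=> a01.
have H b : (forall m, 0 <= b m <= 1) -> forall x,
    cvgn (pseries (fun m => b m / m`!%:R) x).
  move=> b01 x; have /cvgP := @cvg_egf b x b01.
  rewrite /pseries (_ : (fun m => x ^+ m / _ * _) =
    (fun m => b m / m`!%:R * x ^+ m))//.
  by apply/funext => m /=; rewrite mulrC mulrA mulrAC.
rewrite !egf_pseries.
have /= := @pseries_snd_diffs _ (fun m => a m / m`!%:R) (`|t| + 1) t.
rewrite !pseries_diffs_fact; apply.
- exact: H.
- by apply: (H (fun m => a m.+1)) => m.
- by apply: (H (fun m => a m.+2)) => m.
- by rewrite [ltRHS]ger0_norm// ?addr_ge0// ltrDl.
Qed.

(** This linearity turns the recursions for kernel powers into the Kolmogorov equations. *)
Lemma egf_sum (I : finType) (c : I -> R) (a : I -> nat -> R) t :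
  (forall i m, 0 <= a i m <= 1) ->
  egf (fun m => \sum_i c i * a i m) t = \sum_i c i * egf (a i) t.
Proof.
move=> a01; apply: cvg_lim => //.
have -> : series (fun m => t ^+ m / m`!%:R * (\sum_i c i * a i m)) =
    (fun n => \sum_i c i * series (fun m => t ^+ m / m`!%:R * a i m) n).
  apply/funext => n; rewrite /series /=.
  under eq_bigr do rewrite mulr_sumr.
  rewrite exchange_big /=; apply: eq_bigr => i _; rewrite mulr_sumr.
  by apply: eq_bigr => m _; rewrite mulrCA.
apply: cvg_big => [|i _]; first exact: add_continuous.
by apply: cvgM; [exact: cvg_cst|exact: cvg_egf].
Qed.

Lemma egf_ge_series a t n : 0 <= t -> (forall m, 0 <= a m <= 1) ->
  series (fun m => t ^+ m / m`!%:R * a m) n <= egf a t.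
Proof.
move=> t0 a01; apply: nondecreasing_cvgn_le; last exact/cvgP/cvg_egf.
apply: nondecreasing_series => m _ _.
by have /andP[? _] := a01 m; rewrite mulr_ge0// divr_ge0// exprn_ge0.
Qed.

Lemma egf_ge0 a t : 0 <= t -> (forall m, 0 <= a m <= 1) -> 0 <= egf a t.
Proof.
by move=> t0 a01; apply: le_trans (egf_ge_series 0 t0 a01); rewrite /series/= big_nil.
Qed.

Lemma egf_le_expR a t : 0 <= t -> (forall m, 0 <= a m <= 1) -> egf a t <= expR t.
Proof.
move=> t0 a01; rewrite /egf /expR; apply: lim_series_le.
- exact/cvgP/cvg_egf.
- exact: is_cvg_series_exp_coeff.
- move=> m; have /andP[_ a1] := a01 m.
  by rewrite /exp_coeff /= ler_piMr// divr_ge0// exprn_ge0.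
Qed.

Lemma egf1 t : egf (fun=> 1) t = expR t.
Proof.
rewrite /egf /expR; congr (limn (series _)); apply/funext => m /=.
by rewrite mulr1.
Qed.

Lemma egf0 a : (forall m, 0 <= a m <= 1) -> egf a 0 = a 0%N.
Proof.
move=> a01; apply: cvg_lim => //.
(* The empty partial sum is 0, so the partial sums are constant only from index one on. *)
rewrite -(cvg_shiftS _) /=.
rewrite (_ : (fun n => _) = fun=> a 0%N); first exact: cvg_cst.
apply/funext => n; rewrite /series /= big_nat_recl//= expr0 fact0 divr1 mul1r.
by rewrite big1 ?addr0// => m _; rewrite expr0n /= mul0r mul0r.
Qed.

End ExpGeneratingFunction.

(** * Calculus rules for functions of time *)

Section PointwiseDerivatives.
Variable R : realType.
Implicit Types (f g : R -> R) (x t : R).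

Lemma is_derive_fsum (I : finType) (h : I -> R -> R) (dh : I -> R) x :
  (forall i, is_derive x 1 (h i) (dh i)) ->
  is_derive x 1 (fun s => \sum_i h i s) (\sum_i dh i).
Proof.
move=> hd; have -> : (fun s => \sum_i h i s) = \sum_i h i.
  by apply/funext => s; rewrite fct_sumE.
by elim/big_ind2 : _ => // [|f df g dg *]; [exact: is_derive_cst|exact: is_deriveD].
Qed.

Lemma is_derive_mul f g x df dg :
  is_derive x 1 f df -> is_derive x 1 g dg ->
  is_derive x 1 (fun s => f s * g s) (df * g x + f x * dg).
Proof.
move=> hf hg; apply: (is_derive_eq (is_deriveM hf hg)).
by rewrite /GRing.scale /= addrC [df * _]mulrC.
Qed.

Lemma is_derive_sub f g x df dg :
  is_derive x 1 f df -> is_derive x 1 g dg ->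
  is_derive x 1 (fun s => f s - g s) (df - dg).
Proof. exact: is_deriveB. Qed.

Lemma is_derive_rev f t x df :
  is_derive (t - x) 1 f df -> is_derive x 1 (fun s => f (t - s)) (- df).
Proof.
move=> hf; have h : is_derive x 1 (fun s => t - s) (-1).
  apply: (is_derive_eq (is_deriveB (is_derive_cst t x 1) (is_derive_id x 1))).
  by rewrite sub0r.
have := @is_derive1_comp _ f (fun s => t - s) x df (-1) hf h.
by rewrite mulrN1.
Qed.

Lemma nonincreasing_of_derive f (df : R -> R) t :
  (forall s : R, is_derive s 1 f (df s)) -> (forall s, 0 <= s <= t -> df s <= 0) ->
  0 <= t -> f t <= f 0.
Proof.
move=> hf hdf t0.
have dvf (s : R) : derivable f s 1 by case: (hf s).
have fE (s : R) : derive1 f s = df s by rewrite derive1E; case: (hf s).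
apply: (@ler0_derive1_nincr _ f 0 t) => // s.
- by rewrite in_itv/= fE => /andP[s0 st]; rewrite hdf// !ltW.
- apply: continuous_subspaceT => {}s.
  exact/differentiable_continuous/derivable1_diffP.
Qed.

End PointwiseDerivatives.

(** * Kernel powers and the continuous-time semigroup *)

Section Semigroup.
Variables (R : realType) (X : markov_chain R).
Local Notation P := (@trans R X).
Local Notation pi := (@stat R X).
Local Notation p := (@semigroup R X).
Implicit Types (f g : X -> R) (x y z o : X) (s t : R).

Lemma kpow_ge0 m x y : 0 <= kpow P m x y.
Proof.
elim: m x => [|m IH] x /=; first exact: ler0n.
by apply: sumr_ge0 => z _; rewrite mulr_ge0 ?trans_ge0.
Qed.

Lemma kpow_sum1 m x : \sum_y kpow P m x y = 1.
Proof.
elim: m x => [|m IH] x /=.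
  rewrite (bigD1 x)//= eqxx big1 ?addr0// => y; rewrite eq_sym => /negbTE ->//.
rewrite exchange_big /= -[RHS](trans_sum1 x); apply: eq_bigr => z _.
by rewrite -mulr_sumr IH mulr1.
Qed.

Lemma kpow_01 m x y : 0 <= kpow P m x y <= 1.
Proof.
rewrite kpow_ge0 -(kpow_sum1 m x) (bigD1 y)//= lerDl.
by apply: sumr_ge0 => z _; exact: kpow_ge0.
Qed.

Lemma kpowSr m x y : kpow P m.+1 x y = \sum_z kpow P m x z * P z y.
Proof.
elim: m x => [|m IH] x.
  rewrite /= (bigD1 y)//= eqxx mulr1 big1 ?addr0; last first.
    by move=> z /negbTE->; rewrite mulr0.
  rewrite (bigD1 x)//= eqxx mul1r big1 ?addr0// => z.
  by rewrite eq_sym => /negbTE->; rewrite mul0r.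
change (\sum_z P x z * kpow P m.+1 z y = \sum_z kpow P m.+1 x z * P z y).
under eq_bigr do rewrite IH mulr_sumr.
rewrite exchange_big /=; apply: eq_bigr => z _.
by rewrite mulr_suml; apply: eq_bigr => w _; rewrite mulrA.
Qed.

Lemma semigroup_egf t x y : p t x y = expR (- t) * egf (fun m => kpow P m x y) t.
Proof. by []. Qed.

Lemma semigroup_ge0 t x y : 0 <= t -> 0 <= p t x y.
Proof.
move=> t0; rewrite semigroup_egf mulr_ge0 ?expR_ge0//.
by apply: egf_ge0 => // m; exact: kpow_01.
Qed.

Lemma semigroup_sum1 t x : \sum_y p t x y = 1.
Proof.
have := @egf_sum _ X (fun=> 1) (fun y m => kpow P m x y) t (fun y m => kpow_01 m x y).
under [RHS]eq_bigr do rewrite mul1r.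
under eq_fun do rewrite -mulr_sumr kpow_sum1 mulr1.
by rewrite egf1 -mulr_sumr => <-; rewrite mulrC expRxMexpNx_1.
Qed.

Lemma semigroup0 x y : p 0 x y = (x == y)%:R.
Proof.
by rewrite semigroup_egf oppr0 expR0 mul1r egf0// => m; exact: kpow_01.
Qed.

Let is_derive_semigroup_egf t x y : is_derive t 1 (fun t => p t x y)
  (expR (- t) * egf (fun m => kpow P m.+1 x y) t - p t x y).
Proof.
have h1 : is_derive t 1 (fun t => expR (- t)) (- expR (- t)).
  have -> : (fun t => expR (- t)) = (fun s => expR (0 - s) : R).
    by apply/funext => s; rewrite sub0r.
  by rewrite -[- t]sub0r; apply: is_derive_rev; exact: is_derive_expR.
have := is_derive_mul h1 (is_derive_egf t (fun m => kpow_01 m x y)).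
by rewrite mulNr addrC.
Qed.

(** Backward Kolmogorov equation: the first jump is split off. *)
Lemma is_derive_semigroupl t x y : is_derive t 1 (fun t => p t x y)
  (\sum_z P x z * p t z y - p t x y).
Proof.
apply: (is_derive_eq (is_derive_semigroup_egf t x y)); congr (_ - _) => /=.
rewrite (egf_sum (P x))/=; last by move=> *; exact: kpow_01.
by rewrite mulr_sumr; apply: eq_bigr => z _; rewrite mulrCA.
Qed.

(** Forward Kolmogorov equation: the last jump is split off, by [kpowSr]. *)
Lemma is_derive_semigroupr t x y : is_derive t 1 (fun t => p t x y)
  (\sum_z p t x z * P z y - p t x y).
Proof.
apply: (is_derive_eq (is_derive_semigroup_egf t x y)); congr (_ - _).
rewrite (_ : (fun m => _) = (fun m => \sum_z P z y * kpow P m x z)); last first.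
  by apply/funext => m; rewrite kpowSr; apply: eq_bigr => z _; rewrite mulrC.
rewrite (egf_sum (P^~ y))/=; last by move=> *; exact: kpow_01.
by rewrite mulr_sumr; apply: eq_bigr => z _; rewrite mulrCA mulrC.
Qed.

End Semigroup.

(** * Generator, semigroup property and curvature *)

Section Kolmogorov.
Variables (R : realType) (X : markov_chain R).
Local Notation P := (@trans R X).
Local Notation pi := (@stat R X).
Local Notation p := (@semigroup R X).
Implicit Types (f g h : X -> R) (x y z o : X) (s t : R).

Lemma laplacianE f x : laplacian f x = \sum_y P x y * f y - f x.
Proof.
rewrite /laplacian; under eq_bigr do rewrite mulrBr.
by rewrite sumrB -mulr_suml trans_sum1 mul1r.
Qed.

Lemma Gamma_ge0 f x : 0 <= Gamma f f x.
Proof.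
rewrite mulr_ge0 ?invr_ge0//; apply: sumr_ge0 => y _.
by rewrite mulr_ge0 ?trans_ge0// -expr2 sqr_ge0.
Qed.

Lemma laplacian_sqr f x :
  laplacian (fun y => f y ^+ 2) x = 2 * (f x * laplacian f x + Gamma f f x).
Proof.
rewrite /Gamma /laplacian mulrDr !mulr_sumr -big_split /=.
by apply: eq_bigr => y _; field.
Qed.

Lemma is_derive_semigroup_fun t f x :
  is_derive t 1 (fun t => \sum_y p t x y * f y)
    (laplacian (fun z => \sum_y p t z y * f y) x).
Proof.
apply: is_derive_eq; first apply: is_derive_fsum => y.
  exact: (is_derive_mul (is_derive_semigroupl t x y) (is_derive_cst (f y) t 1)).
rewrite laplacianE /=.
under eq_bigr do rewrite mulr0 addr0 mulrBl mulr_suml.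
rewrite sumrB exchange_big /=; congr (_ - _); apply: eq_bigr => z _.
by rewrite mulr_sumr; apply: eq_bigr => y _; rewrite mulrA.
Qed.

(** The forward equation moves the generator from the law onto the observable. The interpolations in
    [semigroupD], [local_poincare] and [mean_semigroup_ddist] are differentiated this way. *)
Lemma is_derive_semigroup_pair s o (F : R -> X -> R) (dF : X -> R) :
  (forall y, is_derive s 1 (F^~ y) (dF y)) ->
  is_derive s 1 (fun s => \sum_y p s o y * F s y)
    (\sum_y p s o y * (laplacian (F s) y + dF y)).
Proof.
move=> hF; apply: is_derive_eq; first apply: is_derive_fsum => y.
  exact: (is_derive_mul (is_derive_semigroupr s o y) (hF y)).
rewrite /= !big_split /=; under [RHS]eq_bigr do rewrite mulrDr.
rewrite big_split/=; congr (_ + _).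
under eq_bigr do rewrite mulrBl mulr_suml.
under [RHS]eq_bigr do rewrite laplacianE mulrBr mulr_sumr.
rewrite !sumrB; congr (_ - _); rewrite exchange_big /=.
by apply: eq_bigr => y _; apply: eq_bigr => z _; rewrite mulrA.
Qed.

(** The interpolation [F u] is constant, because the forward and backward generator terms cancel; it
    is compared at [u = t] and [u = t + s]. *)
Lemma semigroupD t s o y : p (t + s) o y = \sum_z p t o z * p s z y.
Proof.
pose F (u : R) := \sum_z p u o z * p (t + s - u) z y.
have F' (u : R) : is_derive u 1 F 0.
  have h z : is_derive u 1 (fun u => p (t + s - u) z y)
      (- laplacian (fun w => p (t + s - u) w y) z).
    have -> : (fun u => p (t + s - u) z y) = (fun u => (p^~ z)^~ y (t + s - u)).
      by [].
    apply: (@is_derive_rev _ (fun v => p v z y)).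
    by rewrite laplacianE; exact: is_derive_semigroupl.
  have H := is_derive_semigroup_pair o (F := fun u z => p (t + s - u) z y) h.
  apply: (is_derive_eq H).
  by rewrite big1// => z _; rewrite subrr mulr0.
have := @is_derive_0_is_cst _ F (t + s) t F'.
rewrite /F subrr [t + s]addrC addrK => <-.
rewrite (bigD1 y)//= big1 ?addr0 => [|z /negbTE zy]; last first.
  by rewrite semigroup0 zy mulr0.
by rewrite semigroup0 eqxx mulr1 addrC.
Qed.

(** The supremum is only approached: some admissible [k] exceeds [- d], and the loss
    [d * Gamma f f x] is at most [e]. The [+ 1] in [d] keeps its denominator positive. *)
Lemma BE_inequality0 : (0%E <= BE X)%E -> BE_inequality X 0.
Proof.
move=> hBE f x; rewrite mul0r addr0; apply/ler_addgt0Pr => e e0.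
have G0 := Gamma_ge0 f x.
pose d := e / (Gamma f f x + 1).
have d0 : 0 < d by rewrite divr_gt0// ltr_wpDl.
have : ((- d)%:E < BE X)%E by apply: lt_le_trans hBE; rewrite lte_fin oppr_lt0.
move=> /ereal_sup_gt[_ [k hk <-]]; rewrite lte_fin => dk.
have := hk f x; rewrite -lerBrDr => /le_trans; apply; rewrite lerBlDr.
rewrite -addrA lerDl -lerBlDr sub0r.
apply: le_trans (_ : d * Gamma f f x <= e); last first.
  by rewrite /d mulrAC ler_pdivrMr ?ltr_wpDl// mulrDr mulr1 lerDl ltW.
by rewrite -mulNr ler_wpM2r// lerNl ltW.
Qed.

(* The derivative in [s] of the law at time [s] integrated against
   [h_s ^+ 2 - 2 s Gamma h_s], where [h_s] is the semigroup at time [t - s]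
   applied to [g], is nonpositive by the curvature inequality. *)
Lemma local_poincare (BE0 : BE_inequality X 0) g t o : 0 <= t ->
  \sum_y p t o y * g y ^+ 2 - (\sum_y p t o y * g y) ^+ 2 <=
  2 * t * \sum_y p t o y * Gamma g g y.
Proof.
move=> t0.
pose h s y := \sum_z p (t - s) y z * g z.
pose F s y := h s y ^+ 2 - 2 * s * Gamma (h s) (h s) y.
have dh (s : R) y : is_derive s 1 (h^~ y) (- laplacian (h s) y).
  exact: (@is_derive_rev _ (fun u => \sum_z p u y z * g z) _ _ _
    (is_derive_semigroup_fun _ _ _)).
have dG (s : R) y : is_derive s 1 (fun s => Gamma (h s) (h s) y)
    (- (2 * Gamma (h s) (laplacian (h s)) y)).
  have dB z := is_derive_sub (dh s y) (dh s z).
  have dM z := is_derive_mul (is_derive_mul (dB z) (dB z)) (is_derive_cst (P y z) s 1).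
  have dH := is_derive_mul (is_derive_cst (2^-1 : R) s 1) (is_derive_fsum dM).

  apply: (is_derive_eq dH).
  rewrite /= mul0r add0r /Gamma -[RHS]mulN1r !mulr_sumr.
  by apply: eq_bigr => z _; rewrite /cst; field.
have dF (s : R) y : is_derive s 1 (F^~ y)
   (- (2 * h s y * laplacian (h s) y) - 2 * Gamma (h s) (h s) y
    + 4 * s * Gamma (h s) (laplacian (h s)) y).
  have d1 := is_derive_mul (dh s y) (dh s y).
  have d2 := is_derive_mul (is_derive_mul (is_derive_cst (2 : R) s 1) (is_derive_id s 1))
    (dG s y).
  apply: (is_derive_eq (is_derive_sub d1 d2)).
  by rewrite /=; ring.
have := nonincreasing_of_derive
  (fun s => is_derive_semigroup_pair o (dF s)) _ t0.
have -> : \sum_y p 0 o y * F 0 y = (\sum_y p t o y * g y) ^+ 2.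
  rewrite (bigD1 o)//= big1 ?addr0 => [|z]; last first.
    by rewrite eq_sym => /negbTE zo; rewrite semigroup0 zo mul0r.
  by rewrite semigroup0 eqxx mul1r /F /h mulr0 mul0r !subr0.
have ht : h t = g.
  apply/funext => y; rewrite /h subrr (bigD1 y)//= big1 ?addr0 => [|z].
    by rewrite semigroup0 eqxx mul1r.
  by rewrite eq_sym => /negbTE zy; rewrite semigroup0 zy mul0r.
have -> : \sum_y p t o y * F t y =
    \sum_y p t o y * g y ^+ 2 - 2 * t * \sum_y p t o y * Gamma g g y.
  rewrite mulr_sumr -sumrB; apply: eq_bigr => y _.
  by rewrite /F ht; ring.
move=> H; rewrite lerBlDr -lerBlDl; apply: H => s /andP[s0 _].
apply: sumr_le0 => y _; rewrite mulr_ge0_le0 ?semigroup_ge0//.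
have -> : laplacian (F s) y =
    laplacian (fun y => h s y ^+ 2) y - 2 * s * laplacian (Gamma (h s) (h s)) y.
  rewrite /laplacian mulr_sumr -sumrB; apply: eq_bigr => z _.
  by rewrite /F; ring.
(* After cancellation the integrand is [-4 s] times the gap in the curvature inequality for
   [h s]. *)
rewrite laplacian_sqr; have := BE0 (h s) y; rewrite mul0r addr0 => hb.
have : 0 <= s * (2^-1 * laplacian (Gamma (h s) (h s)) y -
  Gamma (h s) (laplacian (h s)) y) by rewrite mulr_ge0// subr_ge0.
lra.
Qed.

End Kolmogorov.

(** * Spectral gap and contraction *)

Section Relaxation.
Variables (R : realType) (X : markov_chain R).
Local Notation P := (@trans R X).
Local Notation pi := (@stat R X).
Local Notation p := (@semigroup R X).
Implicit Types (f g h nu mu : X -> R) (x y z o : X) (s t : R).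

Lemma sumr_gt0_exists (I : finType) (F : I -> R) :
  0 < \sum_i F i -> exists i, 0 < F i.
Proof.
move=> h; apply: contrapT => /forallNP hF; move: h; apply/negP; rewrite -leNgt.
by apply: sumr_le0 => i _; rewrite leNgt; apply/negP/hF.
Qed.

Lemma stat_kpow m y : \sum_x pi x * kpow P m x y = pi y.
Proof.
elim: m y => [|m IH] y /=.
  rewrite (bigD1 y)//= eqxx mulr1 big1 ?addr0// => x /negbTE->.
  by rewrite mulr0.
under eq_bigr do rewrite mulr_sumr.
rewrite exchange_big /= -[RHS]IH; apply: eq_bigr => z _.
by rewrite -[in RHS](stat_invariant z) mulr_suml; apply: eq_bigr => x _; rewrite mulrA.
Qed.

(** Some state has positive mass, and invariance under all powers carries it along a path to [y]. *)
Lemma stat_gt0 y : 0 < pi y.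
Proof.
have : 0 < \sum_x pi x by rewrite stat_sum1.
move=> /sumr_gt0_exists[x x0]; have [m xy] := trans_irreducible x y.
rewrite -(stat_kpow m y) (bigD1 x)//= ltr_pwDl ?mulr_gt0//.
by apply: sumr_ge0 => z _; rewrite mulr_ge0 ?stat_ge0 ?kpow_ge0.
Qed.

(** Stationarity makes the contributions of [f x ^+ 2] and [f y ^+ 2] equal, which leaves the
    quadratic form of the identity minus [P]. *)
Lemma dirichletE f : dirichlet f =
  \sum_x pi x * f x ^+ 2 - \sum_x \sum_y pi x * P x y * f x * f y.
Proof.
have -> : dirichlet f = 2^-1 * \sum_x \sum_y
    (pi x * f x ^+ 2 * P x y + (f y ^+ 2 * (pi x * P x y)
      - 2 * (pi x * P x y * f x * f y))).
  rewrite /dirichlet /Gamma mulr_sumr; apply: eq_bigr => x _.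
  by rewrite -mulrA mulr_suml; congr (_ * _); apply: eq_bigr => y _; ring.
under eq_bigr do rewrite big_split /= -mulr_sumr trans_sum1 mulr1 sumrB -mulr_sumr.
rewrite big_split sumrB /= -mulr_sumr exchange_big /=.
under [X in _ + (X - _)]eq_bigr do rewrite -mulr_sumr stat_invariant mulrC.
by field.
Qed.

Lemma dirichlet_ge0 f : 0 <= dirichlet f.
Proof. by apply: sumr_ge0 => x _; rewrite mulr_ge0 ?Gamma_ge0 ?stat_ge0. Qed.

Lemma edge_le_dirichlet f x y :
  (f x - f y) ^+ 2 * (pi x * P x y) <= 2 * dirichlet f.
Proof.
rewrite /dirichlet (bigD1 x)//= /Gamma (bigD1 y)//=.
set S := \sum_(i | i != y) _; set T := \sum_(i | _) _.
have S0 : 0 <= S * pi x.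
  rewrite mulr_ge0 ?stat_ge0//; apply: sumr_ge0 => z _.
  by rewrite mulr_ge0 ?trans_ge0// -expr2 sqr_ge0.
have T0 : 0 <= T.
  by apply: sumr_ge0 => z _; rewrite mulr_ge0 ?Gamma_ge0 ?stat_ge0.
lra.
Qed.

(** Increments are chained along a path by [(a + b)^2 <= 2 a^2 + 2 b^2]; the constant is crude, but
    it does not depend on [f]. *)
Lemma path_le_dirichlet m x y : 0 < kpow P m x y ->
  exists2 C : R, 0 <= C & forall f, (f x - f y) ^+ 2 <= C * dirichlet f.
Proof.
elim: m x => [|m IH] x /=.
  case: eqVneq => [-> _|_]; last by rewrite ltxx.
  by exists 0 => // f; rewrite subrr expr0n mul0r.
move=> /sumr_gt0_exists[z].
have := trans_ge0 x z; rewrite le_eqVlt => /predU1P[<-|xz]; first by rewrite mul0r ltxx.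
rewrite pmulr_rgt0// => /IH[C C0 hC].
have k0 : 0 < pi x * P x z by rewrite mulr_gt0// stat_gt0.
exists (2 * (2 / (pi x * P x z)) + 2 * C).
  by rewrite addr_ge0 ?mulr_ge0 ?invr_ge0 ?(ltW k0).
move=> f; have := hC f; have := edge_le_dirichlet f x z.
rewrite -ler_pdivlMr// => h1 h2.
have : 0 <= ((f x - f z) - (f z - f y)) ^+ 2 by exact: sqr_ge0.
have -> : (2 * (2 / (pi x * P x z)) + 2 * C) * dirichlet f =
  2 * (2 * dirichlet f / (pi x * P x z)) + 2 * (C * dirichlet f) by ring.
lra.
Qed.

Lemma variance_shift f (c : R) :
  \sum_x (f x - c) ^+ 2 * pi x = Defs.variance f + (mean f - c) ^+ 2.
Proof.
have e (d : R) : \sum_x (f x - d) ^+ 2 * pi x =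
    \sum_x f x ^+ 2 * pi x - 2 * d * mean f + d ^+ 2.
  have -> : d ^+ 2 = \sum_x d ^+ 2 * pi x by rewrite -mulr_sumr stat_sum1 mulr1.
  rewrite /mean mulr_sumr -sumrB -big_split /=.
  by apply: eq_bigr => x _; ring.
rewrite /Defs.variance !e; ring.
Qed.

(** This makes the set defining [trel] bounded above, so that its [sup] is a genuine supremum. *)
Lemma variance_le_dirichlet :
  exists2 C : R, 0 <= C & forall f, Defs.variance f <= C * dirichlet f.
Proof.
have /card_gt0P[b _] : (0 < #|X|)%N by apply: leq_trans (card_state X).
have h x : exists C : R, 0 <= C /\ forall f, (f x - f b) ^+ 2 <= C * dirichlet f.
  have [m xb] := trans_irreducible x b.
  by have [C C0 hC] := path_le_dirichlet xb; exists C.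
move: h => /choice[C hC]; exists (\sum_x C x * pi x).
  by apply: sumr_ge0 => x _; rewrite mulr_ge0 ?stat_ge0//; case: (hC x).
move=> f; apply: (@le_trans _ _ (\sum_x (f x - f b) ^+ 2 * pi x)).
  by rewrite variance_shift lerDl sqr_ge0.
rewrite mulr_suml; apply: ler_sum => x _; rewrite [leRHS]mulrAC.
by rewrite ler_wpM2r ?stat_ge0//; case: (hC x).
Qed.

(** If [dirichlet f] vanishes, [f] gives no quotient in the set defining [trel]; the crude bound
    then forces the variance to vanish. *)
Lemma poincare f : Defs.variance f <= trel X * dirichlet f.
Proof.
have [C C0 hC] := variance_le_dirichlet.
have := dirichlet_ge0 f; rewrite le_eqVlt => /predU1P[E0|E0].
  by rewrite -E0 mulr0; apply: le_trans (hC f) _; rewrite -E0 mulr0.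
rewrite -ler_pdivrMr//; apply: ub_le_sup; last by exists f.
by exists C => _ [g [g0 ->]]; rewrite ler_pdivrMr.
Qed.

Lemma mean_delta x : mean (fun y => (y == x)%:R) = pi x.
Proof.
rewrite /mean (bigD1 x)//= eqxx mul1r big1 ?addr0// => y /negbTE->.
by rewrite mul0r.
Qed.

(** The test function is the indicator of a state [z] of mass at most 1/2: its variance is
    [pi z * (1 - pi z)] and its energy at most [pi z]. *)
Lemma trel_ge : 2^-1 <= trel X.
Proof.
have /card_gt1P[x [y [_ _ xy]]] := card_state X.
have [z hz] : exists z, pi z <= 2^-1.
  have : pi x + pi y <= 1.
    rewrite -(stat_sum1 X) (bigD1 x)//= (bigD1 y)/= 1?eq_sym// addrA lerDl.
    by apply: sumr_ge0 => w _; exact: stat_ge0.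
  by have [h _|h h1] := leP (pi x) 2^-1; [exists x|exists y; lra].
pose f (w : X) : R := (w == z)%:R.
have f2 w : f w ^+ 2 = f w by rewrite /f; case: eqP; rewrite ?expr1n ?expr0n.
have hV : Defs.variance f = pi z * (1 - pi z).
  have := variance_shift f 0; rewrite mean_delta subr0.
  under eq_bigr do rewrite subr0 f2.
  by rewrite -/(mean f) mean_delta => h; lra.
have hE : dirichlet f <= pi z.
  rewrite dirichletE; under eq_bigr do rewrite f2 mulrC.
  rewrite -/(mean f) mean_delta gerBl.
  apply: sumr_ge0 => w _; apply: sumr_ge0 => v _.
  by rewrite !mulr_ge0 ?stat_ge0 ?trans_ge0.
have := poincare f; rewrite hV => hP.
have pz := stat_gt0 z.
(* The sign must be known before the energy is replaced by its upper bound [pi z]. *)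
have t0 : 0 <= trel X.
  rewrite leNgt; apply/negP => t0; have : 0 < pi z * (1 - pi z).
    by rewrite mulr_gt0//; lra.
  by apply/negP; rewrite -leNgt (le_trans hP)// mulr_le0_ge0 ?dirichlet_ge0 ?ltW.
have : pi z * (1 - pi z) <= pi z * trel X.
  by rewrite (le_trans hP)// mulrC ler_wpM2r.
rewrite ler_pM2l// => h; lra.
Qed.

Lemma trel_gt0 : 0 < trel X.
Proof. by apply: lt_le_trans trel_ge; rewrite invr_gt0. Qed.

(** The centred second moment [W] of the density has derivative [- 2 * dirichlet (u s)], so
    [expR (2 / trel X * s) * W s] is nonincreasing by [poincare]. The mass [a] is arbitrary because
    truncated laws will be used. *)
Lemma l2_contraction nu a t : 0 <= t -> \sum_x nu x = a ->
  \sum_y pi y * ((\sum_x nu x * p t x y) / pi y - a) ^+ 2 <=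
  expR (- (2 * t / trel X)) * \sum_y pi y * (nu y / pi y - a) ^+ 2.
Proof.
move=> t0 nua; pose w s y := \sum_x nu x * p s x y.
have sum_w s : \sum_y w s y = a.
  rewrite exchange_big -nua /=; apply: eq_bigr => x _.
  by rewrite -mulr_sumr semigroup_sum1 mulr1.
have dw (s : R) y : is_derive s 1 (w^~ y) (\sum_z w s z * P z y - w s y).
  have d x := is_derive_mul (is_derive_cst (nu x) s 1) (is_derive_semigroupr s x y).
  apply: (is_derive_eq (is_derive_fsum d)).
  rewrite /=; under eq_bigr do rewrite mul0r add0r mulrBr.
  rewrite sumrB; congr (_ - _); under [RHS]eq_bigr do rewrite mulr_suml.
  rewrite exchange_big /=; apply: eq_bigr => x _; rewrite mulr_sumr.
  by apply: eq_bigr => z _; rewrite mulrA.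
pose u s y := w s y / pi y.
pose W s := \sum_y pi y * (u s y - a) ^+ 2.
have piN0 y : pi y != 0 by rewrite gt_eqF// stat_gt0.
have dW (s : R) : is_derive s 1 W (- (2 * dirichlet (u s))).
  have du y : is_derive s 1 (fun s => u s y - a)
      ((\sum_z w s z * P z y - w s y) / pi y).
    apply: (is_derive_eq (is_derive_sub
      (is_derive_mul (dw s y) (is_derive_cst (pi y)^-1 s 1)) (is_derive_cst a s 1))).
    by rewrite mulr0 addr0 subr0.
  have d y := is_derive_mul (is_derive_cst (pi y) s 1) (is_derive_mul (du y) (du y)).
  apply: (is_derive_eq (is_derive_fsum d)).
  have wE z : w s z = pi z * u s z by rewrite /u mulrC divfK.
  transitivity (\sum_y (2 * (u s y - a) * (\sum_z w s z * P z y - w s y))).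
    by apply: eq_bigr => y _; rewrite mul0r add0r /cst; field; exact: piN0.
  (* The term in [a] is isolated; it vanishes since the forward equation conserves mass. *)
  have -> : \sum_y 2 * (u s y - a) * (\sum_z w s z * P z y - w s y) =
     2 * (\sum_y u s y * (\sum_z w s z * P z y) - \sum_y u s y * w s y)
     - 2 * a * (\sum_y \sum_z w s z * P z y - \sum_y w s y).
    rewrite -!sumrB !mulr_sumr -sumrB; apply: eq_bigr => y _; ring.
  have -> : \sum_y \sum_z w s z * P z y = \sum_y w s y.
    rewrite exchange_big /=; apply: eq_bigr => z _.
    by rewrite -mulr_sumr trans_sum1 mulr1.
  rewrite subrr mulr0 subr0 dirichletE -mulrN opprB; congr (2 * (_ - _)).
    under eq_bigr do rewrite mulr_sumr.
    rewrite exchange_big /=; apply: eq_bigr => z _; apply: eq_bigr => y _.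
    by rewrite wE; ring.
  by apply: eq_bigr => y _; rewrite wE; ring.
have WE s : W s = Defs.variance (u s).
  have hm : mean (u s) = a.
    by rewrite -(sum_w s); apply: eq_bigr => y _; rewrite /u divfK.
  by rewrite /Defs.variance hm; apply: eq_bigr => y _; rewrite mulrC.
have dexp (s : R) : is_derive s 1 (fun s => expR (2 / trel X * s))
    (2 / trel X * expR (2 / trel X * s)).
  have d := is_derive_mul (is_derive_cst (2 / trel X) s 1) (is_derive_id s 1).
  have := @is_derive1_comp _ expR _ _ _ _ (is_derive_expR _) d.
  move=> /is_derive_eq; apply.
  by rewrite mul0r add0r mulr1 mulrC.
have := nonincreasing_of_derive (fun s => is_derive_mul (dexp s) (dW s)) _ t0.
rewrite mulr0 expR0 mul1r => H.
rewrite expRN ler_pdivlMl ?expR_gt0// [2 * t / _]mulrAC -/(W t).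
have -> : \sum_y pi y * (nu y / pi y - a) ^+ 2 = W 0.
  apply: eq_bigr => y _; rewrite /u /w (bigD1 y)//= semigroup0 eqxx mulr1.
  rewrite big1 ?addr0// => x /negbTE xy.
  by rewrite semigroup0 xy mulr0.
apply: H => s _.
set e := expR _.
have -> : 2 / trel X * e * W s + e * - (2 * dirichlet (u s)) =
  2 * e * (W s / trel X - dirichlet (u s)) by ring.
rewrite pmulr_rle0 ?mulr_gt0 ?expR_gt0// subr_le0 ler_pdivrMr ?trel_gt0//.
by rewrite WE mulrC poincare.
Qed.

End Relaxation.

(** * Total variation bounds from density bounds *)

Section Mixing.
Variables (R : realType) (X : markov_chain R).
Local Notation P := (@trans R X).
Local Notation pi := (@stat R X).
Local Notation p := (@semigroup R X).
Implicit Types (f g h nu mu : X -> R) (x y z o : X) (s t eps : R).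

Lemma tv_dist_ge (A : pred X) mu : \sum_x mu x = 1 ->
  \sum_(x | A x) mu x - \sum_(x | A x) pi x <= tv_dist mu pi.
Proof.
move=> mu1; rewrite /tv_dist ler_pdivlMl//.
have := stat_sum1 X; rewrite (bigID A)/= => e1.
move: mu1; rewrite (bigID A)/= => e2.
rewrite [leRHS](bigID A)/=.
have h1 : \sum_(x | A x) mu x - \sum_(x | A x) pi x <=
    \sum_(x | A x) `|mu x - pi x|.
  by rewrite -sumrB; apply: ler_sum => x _; exact: ler_norm.
have h2 : \sum_(x | ~~ A x) pi x - \sum_(x | ~~ A x) mu x <=
    \sum_(x | ~~ A x) `|mu x - pi x|.
  by rewrite -sumrB; apply: ler_sum => x _; rewrite distrC; exact: ler_norm.
lra.
Qed.

(** Restricted to [A], [mu] has density at most [expR M], hence second moment at most [expR M],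
    which contracts below [eps ^+ 2]. The removed mass, at most [eps / 2], enters twice, and the
    factor 1/2 in [tv_dist] leaves [eps]. *)
Lemma tv_dist_semigroup_le (A : pred X) mu eps M s :
  (forall x, 0 <= mu x) -> \sum_x mu x = 1 ->
  \sum_(x | ~~ A x) mu x <= eps / 2 ->
  (forall x, A x -> mu x <= expR M * pi x) ->
  0 < eps -> 0 <= s -> expR (M - 2 * s / trel X) <= eps ^+ 2 ->
  tv_dist (fun y => \sum_x mu x * p s x y) pi <= eps.
Proof.
move=> mu0 mu1 muA muM e0 s0 hs.
pose nu x := if A x then mu x else 0.
have [a aE] : exists a, a = \sum_x nu x by eexists.
have nu0 x : 0 <= nu x by rewrite /nu; case: ifP.
have nuE : a = \sum_(x | A x) mu x by rewrite aE [RHS]big_mkcond.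
have a1 : 1 - a = \sum_(x | ~~ A x) mu x.
  by move: mu1; rewrite (bigID A)/= -nuE; lra.
have a1' : 0 <= 1 - a by rewrite a1; apply: sumr_ge0.
pose u y := (\sum_x nu x * p s x y) / pi y.
have W : \sum_y pi y * (u y - a) ^+ 2 <= eps ^+ 2.
  apply: le_trans (l2_contraction s0 (esym aE)) _; apply: le_trans hs.
  rewrite expRD mulrC ler_wpM2r ?expR_ge0//.
  apply: (@le_trans _ _ (\sum_y nu y * (nu y / pi y))).
    have -> : \sum_y pi y * (nu y / pi y - a) ^+ 2 =
        \sum_y nu y * (nu y / pi y) - a ^+ 2.
      have -> : a ^+ 2 = 2 * a * (\sum_y nu y) - a ^+ 2 * \sum_y pi y.
        by rewrite stat_sum1 -aE; ring.
      rewrite !mulr_sumr -!sumrB; apply: eq_bigr => y _.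
      by field; rewrite gt_eqF// stat_gt0.
    by rewrite gerBl sqr_ge0.
  apply: (@le_trans _ _ (expR M * a)).
    rewrite aE mulr_sumr; apply: ler_sum => y _; rewrite mulrC ler_wpM2r//.
    rewrite ler_pdivrMr ?stat_gt0// /nu; case: ifP => [/muM//|_].
    by rewrite mulr_ge0 ?expR_ge0 ?stat_ge0.
  by rewrite ler_piMr ?expR_ge0// -subr_ge0.
have hu : \sum_y pi y * `|u y - a| <= eps.
  (* This pointwise inequality, weighted by [eps], replaces Cauchy-Schwarz. *)
  have amgm y : pi y * `|u y - a| <=
      2^-1 * (pi y * (u y - a) ^+ 2 / eps + eps * pi y).
    rewrite mulrAC -mulrA [eps * _]mulrC -mulrDr mulrCA ler_wpM2l ?stat_ge0//.
    rewrite -real_normK ?num_real//; set v := `|_|.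
    have : 0 <= (v - eps) ^+ 2 / eps by rewrite divr_ge0 ?sqr_ge0 ?ltW.
    have -> : (v - eps) ^+ 2 / eps = v ^+ 2 / eps + eps - 2 * v.
      by field; rewrite gt_eqF.
    by rewrite [_^-1 * v ^+ 2]mulrC; lra.
  apply: le_trans (ler_sum _ (fun y _ => amgm y)) _.
  rewrite -mulr_sumr big_split/= -mulr_suml -mulr_sumr stat_sum1 mulr1.
  have : (\sum_y pi y * (u y - a) ^+ 2) / eps <= eps.
    by rewrite ler_pdivrMr// -expr2.
  lra.
rewrite /tv_dist.
(* The three terms are the image of the removed mass, the fluctuation of the truncated density
   around [a], and the missing multiple of [pi]. *)
have hy y : `|\sum_x mu x * p s x y - pi y| <=
    \sum_x (mu x - nu x) * p s x y + pi y * `|u y - a| + (1 - a) * pi y.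
  have -> : \sum_x mu x * p s x y - pi y = (\sum_x (mu x - nu x) * p s x y)
      + pi y * (u y - a) - (1 - a) * pi y.
    under [in RHS]eq_bigr do rewrite mulrBl.
    by rewrite sumrB /u; field; rewrite gt_eqF// stat_gt0.
  apply: le_trans (ler_normB _ _) _; apply: lerD; last first.
    by rewrite ger0_norm// mulr_ge0 ?stat_ge0.
  apply: le_trans (ler_normD _ _) _; apply: lerD; last first.
    by rewrite normrM ger0_norm ?stat_ge0.
  rewrite ger0_norm//; apply: sumr_ge0 => x _.
  rewrite mulr_ge0 ?semigroup_ge0// /nu; case: ifP; rewrite ?subrr ?subr0//.
have : \sum_y `|\sum_x mu x * p s x y - pi y| <= (1 - a) + eps + (1 - a).
  apply: le_trans (ler_sum _ (fun y _ => hy y)) _.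
  rewrite !big_split/= -mulr_sumr stat_sum1 mulr1.
  apply: lerD => //; apply: lerD => //.
  rewrite exchange_big /=.
  under eq_bigr do rewrite -mulr_sumr semigroup_sum1 mulr1.
  by rewrite sumrB mu1 -aE.
rewrite -a1 in muA; lra.
Qed.

Lemma worst_tv_leP t eps : 0 <= eps ->
  worst_tv X t <= eps <-> forall o, tv_dist (p t o) pi <= eps.
Proof.
move=> e0; split=> [h o|h]; last exact: bigmax_le.
by apply: le_trans h; exact: (le_bigmax _ _ o).
Qed.

(** A Dirac mass at [o] has density at most [(pi o)^-1 <= M <= expR M]; the time [s] makes the
    exponent [- (M + 2 * eps ^- 2)]. *)
Lemma mixing_time_exists eps : 0 < eps -> exists2 t, 0 <= t & worst_tv X t <= eps.
Proof.
move=> e0.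
pose M := \sum_o (pi o)^-1.
pose s := trel X * (M + eps ^- 2).
have t0 := trel_gt0 X.
have M0 : 0 <= M by apply: sumr_ge0 => o _; rewrite invr_ge0 stat_ge0.
have s0 : 0 <= s by rewrite mulr_ge0 ?addr_ge0 ?invr_ge0 ?sqr_ge0// ltW.
exists s => //; apply/worst_tv_leP => [|o]; first exact: ltW.
pose d x : R := (x == o)%:R.
have -> : p s o = fun y => \sum_x d x * p s x y.
  apply/funext => y; rewrite (bigD1 o)//= /d eqxx mul1r big1 ?addr0// => x.
  by move/negbTE->; rewrite mul0r.
apply: (@tv_dist_semigroup_le predT _ _ M) => //.
- by rewrite (bigD1 o)//= /d eqxx big1 ?addr0// => x /negbTE->.
- by rewrite big1// divr_ge0// ltW.
- move=> x _; rewrite /d; case: eqVneq => [->|_] /=; last first.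
    by rewrite mulr_ge0 ?expR_ge0 ?stat_ge0.
  rewrite -ler_pdivrMr ?stat_gt0// mul1r.
  apply: le_trans (_ : M <= _).
    rewrite /M (bigD1 o)//= lerDl; apply: sumr_ge0 => z _.
    by rewrite invr_ge0 stat_ge0.
  by apply: le_trans (expR_ge1Dx M); rewrite lerDr.
- have -> : M - 2 * s / trel X = - (M + 2 * eps ^- 2).
    by rewrite /s; field; rewrite !gt_eqF.
  rewrite expRN -[leRHS]invrK lef_pV2 ?posrE ?expR_gt0 ?invr_gt0 ?exprn_gt0//.
  apply: le_trans (expR_ge1Dx _).
  have : 0 < (eps ^+ 2)^-1 by rewrite invr_gt0 exprn_gt0.
  lra.
Qed.

End Mixing.

(** * Directed distance and diameter *)

Section Distance.
Variables (R : realType) (X : markov_chain R).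
Local Notation P := (@trans R X).
Local Notation pi := (@stat R X).
Local Notation p := (@semigroup R X).
Local Notation k := (kmax X).
Implicit Types (f g h : X -> R) (x y z o : X) (s t eps : R).

Lemma ddistP x y : 0 < kpow P (ddist x y) x y.
Proof. by rewrite /ddist; case: ex_minnP. Qed.

Lemma ddist_le m x y : 0 < kpow P m x y -> (ddist x y <= m)%N.
Proof. by rewrite /ddist; case: ex_minnP => n _ h /h. Qed.

Lemma kpow_gt0S m x y : 0 < kpow P m.+1 x y ->
  exists z, 0 < P x z /\ 0 < kpow P m z y.
Proof.
move=> /sumr_gt0_exists[z h]; exists z; move: h.
have := trans_ge0 x z; rewrite le_eqVlt => /predU1P[<-|xz].
  by rewrite mul0r ltxx.
by rewrite pmulr_rgt0.
Qed.

Lemma kpow_gt0D m n x y z : 0 < kpow P m x z -> 0 < kpow P n z y ->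
  0 < kpow P (m + n) x y.
Proof.
elim: m x => [|m IH] x.
  by rewrite add0n /=; case: eqVneq => [->|]; rewrite ?ltxx.
move=> /kpow_gt0S[w [xw wz]] zy; rewrite addSn /= (bigD1 w)//=.
rewrite ltr_pwDl ?mulr_gt0 ?IH//; apply: sumr_ge0 => v _.
by rewrite mulr_ge0 ?trans_ge0 ?kpow_ge0.
Qed.

Lemma kpow1 x y : kpow P 1 x y = P x y.
Proof.
rewrite /= (bigD1 y)//= eqxx mulr1 big1 ?addr0// => z /negbTE->.
by rewrite mulr0.
Qed.

Lemma ddist_triangle z x y : (ddist x y <= ddist x z + ddist z y)%N.
Proof. by apply/ddist_le/kpow_gt0D; exact: ddistP. Qed.

Lemma ddistxx x : ddist x x = 0%N.
Proof. by apply/eqP; rewrite -leqn0; apply: ddist_le; rewrite /= eqxx. Qed.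

Lemma ddist_eq0 x y : ddist x y = 0%N -> x = y.
Proof.
move=> h; have := ddistP x y; rewrite h /=.
by case: eqVneq => //; rewrite ltxx.
Qed.

Lemma ddist_edge x y : x != y -> 0 < P x y -> ddist x y = 1%N.
Proof.
move=> xy Pxy; apply/eqP; rewrite eqn_leq ddist_le ?kpow1//= lt0n.
by apply: contra_neq xy => /ddist_eq0.
Qed.

Lemma ddist_rev_edge x y : 0 < P x y -> (ddist y x <= k)%N.
Proof.
move=> Pxy; case: (eqVneq x y) => [->|xy]; first by rewrite ddistxx.
by apply: (@leq_bigmax_cond _ _ _ (x, y)); rewrite ddist_edge.
Qed.

Lemma exists_edge x y : x != y -> exists2 z, x != z & 0 < P x z.
Proof.
move=> xy; have [m] := trans_irreducible x y.
elim: m => [|m IH] /=; first by rewrite (negbTE xy) ltxx.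
move=> /kpow_gt0S[z [xz zy]].
by case: (eqVneq x z) => [xzE|xz']; [move: zy; rewrite -xzE => /IH|exists z].
Qed.

Lemma kmax_gt0 : (0 < k)%N.
Proof.
have /card_gt1P[x [y [_ _ xy]]] := card_state X.
have [z xz Pxz] := exists_edge xy; apply: leq_trans (ddist_rev_edge Pxz).
by rewrite lt0n; apply: contra_neq xz => /ddist_eq0.
Qed.

Lemma kmax_ge1 : 1 <= k%:R :> R.
Proof. by rewrite ler1n kmax_gt0. Qed.

Lemma trans_le1 x y : P x y <= 1.
Proof. by rewrite -kpow1; have /andP[] := kpow_01 1 x y. Qed.

Lemma Delta_ge x y : x != y -> 0 < P x y -> 1 <= Delta X * P x y.
Proof.
move=> xy Pxy; rewrite -ler_pdivrMr// mul1r.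
by apply: (@le_bigmax_cond _ _ _ _ (x, y)); rewrite Pxy.
Qed.

Lemma Delta_ge1 : 1 <= Delta X.
Proof.
have /card_gt1P[x [y [_ _ xy]]] := card_state X.
have [z xz Pxz] := exists_edge xy.
have := Delta_ge xz Pxz; have := trans_le1 x z => h1 h2.
have D0 : 0 <= Delta X.
  by have : 0 < Delta X * P x z by [exact: lt_le_trans h2]; rewrite pmulr_lgt0// => /ltW.
by apply: le_trans h2 _; rewrite ler_piMr.
Qed.

Lemma lipschitz_path g (K : R) m x y : 0 <= K ->
  (forall x y, x != y -> 0 < P x y -> g x - g y <= K) ->
  0 < kpow P m x y -> g x - g y <= K * m%:R.
Proof.
move=> K0 hg; elim: m x => [|m IH] x /=.
  by case: eqVneq => [->|]; rewrite ?ltxx// mulr0 subrr.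
move=> /kpow_gt0S[z [xz /IH hz]].
have : g x - g z <= K by case: (eqVneq x z) => [->|/hg]; [rewrite subrr|exact].
by rewrite -natr1 mulrDr mulr1; lra.
Qed.

(** The one-sided bound adds up along a directed path leading back across the edge, of length at
    most [k]. *)
Lemma lipschitz_rev_edge g (K : R) x y : 0 <= K ->
  (forall x y, x != y -> 0 < P x y -> g x - g y <= K) ->
  0 < P x y -> g y - g x <= K * k%:R.
Proof.
move=> K0 hg Pxy; apply: le_trans (lipschitz_path K0 hg (ddistP y x)) _.
by rewrite ler_wpM2l// ler_nat ddist_rev_edge.
Qed.

Lemma Gamma_le f (K : R) x : 0 <= K ->
  (forall y, x != y -> 0 < P x y -> `|f x - f y| <= K) ->
  Gamma f f x <= K ^+ 2 / 2.
Proof.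
move=> K0 hf; rewrite /Gamma mulrC ler_wpM2r ?invr_ge0//.
apply: (@le_trans _ _ (\sum_y K ^+ 2 * P x y)); last first.
  by rewrite -mulr_sumr trans_sum1 mulr1.
apply: ler_sum => y _.
have := trans_ge0 x y; rewrite le_eqVlt => /predU1P[<-|xy]; first by rewrite !mulr0.
rewrite ler_pM2r// -expr2 -real_normK ?num_real// lerXn2r ?nnegrE//.
by case: (eqVneq x y) => [->|/hf]; [rewrite subrr normr0|exact].
Qed.

Lemma ddist_lipschitz o x y : x != y -> 0 < P x y ->
  - (ddist o x)%:R - - (ddist o y)%:R <= 1 :> R.
Proof.
move=> xy Pxy; rewrite opprK addrC lerBlDl natr1 ler_nat.
by have := ddist_triangle x o y; rewrite (ddist_edge xy Pxy) addn1.
Qed.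

Lemma ddist_norm_le o x y : x != y -> 0 < P x y ->
  `|(ddist o x)%:R - (ddist o y)%:R| <= k%:R :> R.
Proof.
move=> xy Pxy; rewrite ler_norml; apply/andP; split.
  by have := ddist_lipschitz o xy Pxy; have := kmax_ge1; lra.
have := @lipschitz_rev_edge (fun x => - (ddist o x)%:R) 1 x y ler01
  (@ddist_lipschitz o) Pxy.
by rewrite mul1r; lra.
Qed.

(** Along an edge the distance back to [x] grows by at most [k], the cost of undoing the edge. *)
Lemma ddist_rev x y : (ddist y x)%:R <= k%:R * (ddist x y)%:R :> R.
Proof.
have := @lipschitz_path (fun v => - (ddist v x)%:R) k%:R (ddist x y) x y
  (ler0n _ _) _ (ddistP x y).
rewrite ddistxx oppr0 opprK add0r; apply => u v uv Puv.
rewrite opprK addrC lerBlDl -natrD ler_nat.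
apply: leq_trans (ddist_triangle u v x) _.
by rewrite addnC leq_add2l ddist_rev_edge.
Qed.

(** The distance minus time has nonpositive drift: jumps come at rate one and raise the distance
    from [o] by at most one. *)
Lemma mean_semigroup_ddist t o : 0 <= t ->
  \sum_y p t o y * (ddist o y)%:R <= t.
Proof.
move=> t0; pose F s y : R := (ddist o y)%:R - s.
have dF (s : R) y : is_derive s 1 (F^~ y) (0 - 1).
  exact: (is_derive_sub (is_derive_cst ((ddist o y)%:R : R) s 1) (is_derive_id s 1)).
have := nonincreasing_of_derive
  (fun s => is_derive_semigroup_pair o (dF s)) _ t0.
have FE s : \sum_y p s o y * F s y = \sum_y p s o y * (ddist o y)%:R - s.
  under eq_bigr do rewrite mulrBr.
  by rewrite sumrB -mulr_suml semigroup_sum1 mul1r.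
rewrite !FE => h; rewrite -subr_le0; apply: le_trans (h _) _.
  move=> s /andP[s0 _]; apply: sumr_le0 => y _.
  rewrite mulr_ge0_le0 ?semigroup_ge0// sub0r subr_le0.
  rewrite -[leRHS](trans_sum1 y) /laplacian; apply: ler_sum => z _.
  have := trans_ge0 y z; rewrite le_eqVlt => /predU1P[<-|yz]; first by rewrite mul0r.
  rewrite ler_piMr ?trans_ge0// /F.
  case: (eqVneq y z) => [->|yz']; first by rewrite subrr.
  by have := ddist_lipschitz o yz' yz; lra.
rewrite subr0 (bigD1 o)//= ddistxx mulr0 add0r.
by rewrite big1// => y; rewrite eq_sym => /negbTE yo; rewrite semigroup0 yo mul0r.
Qed.

(** By Markov's inequality and the overlap, the ball of radius [c = 2 * t / eps] has [pi]-mass at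
    least [eps / 2]. A mean above [c + r] would push the variance above [r ^+ 2 * (eps / 2)],
    against [poincare] for a function with increments at most [k]. *)
Lemma mean_ddist_le t eps r o : 0 < t -> 0 < eps -> worst_tv X t <= 1 - eps ->
  eps <= 1 -> 0 <= r -> k%:R ^+ 2 * trel X <= eps * r ^+ 2 ->
  mean (fun y => (ddist o y)%:R) <= 2 * t / eps + r.
Proof.
move=> t0 e0 /worst_tv_leP htv e1 r0 hr.
move: htv; rewrite subr_ge0 e1 => /(_ isT o) htv.
pose f y : R := (ddist o y)%:R; rewrite -/f.
pose c := 2 * t / eps.
have c0 : 0 < c by rewrite divr_gt0// mulr_gt0.
have [//|mc] := leP (mean f) (c + r).
pose A := [pred y | f y <= c].
have pA : \sum_(y | ~~ A y) p t o y <= eps / 2.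
  have -> : eps / 2 = t / c by rewrite /c; field; rewrite !gt_eqF.
  rewrite ler_pdivlMr//; apply: le_trans (mean_semigroup_ddist o (ltW t0)).
  rewrite [leRHS](bigID A)/= mulr_suml ler_wpDl//.
    by apply: sumr_ge0 => y _; apply: mulr_ge0 => //; exact/semigroup_ge0/ltW.
  apply: ler_sum => y; rewrite -ltNge => /ltW h.
  by rewrite ler_wpM2l//; exact/semigroup_ge0/ltW.
have piA : eps / 2 <= \sum_(y | A y) pi y.
  have := tv_dist_ge A (semigroup_sum1 t o).
  by move: (semigroup_sum1 t o); rewrite (bigID A)/=; lra.
have V : Defs.variance f <= trel X * (k%:R ^+ 2 / 2).
  apply: le_trans (poincare f) _; rewrite ler_pM2l ?trel_gt0//.
  have -> : k%:R ^+ 2 / 2 = \sum_x k%:R ^+ 2 / 2 * pi x :> R.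
    by rewrite -mulr_sumr stat_sum1 mulr1.
  apply: ler_sum => x _.
  rewrite ler_wpM2r ?stat_ge0//; apply: Gamma_le => [|y xy Pxy]; first exact: ler0n.
  exact: ddist_norm_le.
have : (mean f - c) ^+ 2 * (eps / 2) <= Defs.variance f.
  apply: (@le_trans _ _ (\sum_(y | A y) (mean f - c) ^+ 2 * pi y)).
    by rewrite -mulr_sumr ler_wpM2l ?sqr_ge0.
  rewrite /Defs.variance [leRHS](bigID A)/= ler_wpDr//.
    by apply: sumr_ge0 => y _; rewrite mulr_ge0 ?sqr_ge0 ?stat_ge0.
  apply: ler_sum => y Ay; rewrite ler_wpM2r ?stat_ge0//.
  rewrite -[leRHS]sqrrN opprB lerXn2r ?nnegrE//; last by rewrite lerD2l lerN2.
    by rewrite subr_ge0 ltW// (le_lt_trans _ mc)// lerDl.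
  by rewrite subr_ge0 (le_trans Ay)// ltW// (le_lt_trans _ mc)// lerDl.
have : r ^+ 2 < (mean f - c) ^+ 2.
  by rewrite ltr_pXn2r ?nnegrE//; lra.
rewrite -(ltr_pM2r e0) => h1 h2; exfalso; lra.
Qed.

(** The triangle inequality is averaged over an intermediate point [z] of law [pi], and the second
    leg is reversed at cost [k]; then [1 + k <= 2 k]. *)
Lemma diameter_le t eps r : 0 < t -> 0 < eps -> worst_tv X t <= 1 - eps ->
  eps <= 1 -> 0 <= r -> k%:R ^+ 2 * trel X <= eps * r ^+ 2 ->
  forall x y, (ddist x y)%:R <= 2 * k%:R * (2 * t / eps + r).
Proof.
move=> t0 e0 htv e1 r0 hr x y.
have hx := mean_ddist_le x t0 e0 htv e1 r0 hr.
have hy := mean_ddist_le y t0 e0 htv e1 r0 hr.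
have : (ddist x y)%:R <= mean (fun z => (ddist x z)%:R) +
    k%:R * mean (fun z => (ddist y z)%:R).
  have -> : (ddist x y)%:R = \sum_z (ddist x y)%:R * pi z :> R.
    by rewrite -mulr_sumr stat_sum1 mulr1.
  rewrite /mean mulr_sumr -big_split/=.
  apply: ler_sum => z _; rewrite mulrA -mulrDl ler_wpM2r ?stat_ge0//.
  apply: le_trans (_ : (ddist x z + ddist z y)%:R <= _).
    by rewrite ler_nat ddist_triangle.
  by rewrite natrD lerD2l ddist_rev.
move=> /le_trans; apply; have k1 := kmax_ge1.
have c0 : 0 <= 2 * t / eps + r.
  by rewrite addr_ge0// divr_ge0// ?mulr_ge0// ltW.
have : k%:R * mean (fun z => (ddist y z)%:R) <= k%:R * (2 * t / eps + r).
  by rewrite ler_wpM2l.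
have : 1 * (2 * t / eps + r) <= k%:R * (2 * t / eps + r) by rewrite ler_wpM2r.
lra.
Qed.

End Distance.

(** * Logarithmic gradient of the density *)

Section LogGradient.
Variables (R : realType) (X : markov_chain R).
Local Notation P := (@trans R X).
Local Notation pi := (@stat R X).
Local Notation p := (@semigroup R X).
Local Notation k := (kmax X).
Local Notation D := (Delta X).
Implicit Types (f g h : X -> R) (x y z o : X) (s t eps B M : R).

Lemma expR1_le4 : expR 1 <= 4 :> R.
Proof.
have h : 2^-1 <= expR (- 2^-1) :> R.
  by apply: le_trans (expR_ge1Dx _); lra.
have -> : 1 = 2^-1 + 2^-1 :> R by lra.
have h2 : expR 2^-1 <= 2 :> R.
  by rewrite -[leLHS]invrK -expRN -[leRHS]invrK lef_pV2// posrE// ?invr_gt0 ?expR_gt0.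
rewrite expRD; apply: le_trans (ler_pM (expR_ge0 _) (expR_ge0 _) h2 h2) _.
lra.
Qed.

(** A smooth form of [v^-1 >= M^-1] for [v <= M]; the Poisson series then need not be split at
    [M]. *)
Lemma invr_ge_exp (v M : R) : 0 < v -> 0 < M -> (1 - expR (v - M)) / M <= v^-1.
Proof.
move=> v0 M0; have [vM|Mv] := leP v M.
  apply: (@le_trans _ _ M^-1); last by rewrite lef_pV2.
  by rewrite ler_piMl ?invr_ge0 ?(ltW M0)// gerBl expR_ge0.
apply: (@le_trans _ _ 0); last by rewrite invr_ge0 ltW.
rewrite mulr_le0_ge0 ?invr_ge0 ?(ltW M0)// subr_le0 -expR0 ler_expR.
by rewrite subr_ge0 ltW.
Qed.

(* The law at time [t] dominates the law one step earlier up to the factor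
   [t / m.+1] between consecutive Poisson weights, and [m.+1] is at most [M]
   outside an event of exponentially small probability. *)
Lemma semigroup_step o x y t M : 0 < t -> 0 < M ->
  P y x * (t / M) * (p t o y - expR (1 - M + (expR 1 - 1) * t)) <= p t o x.
Proof.
move=> t0 M0.
pose a m := kpow P m o y; pose b m := kpow P m o x.
have a01 m : 0 <= a m <= 1 by exact: kpow_01.
have b01 m : 0 <= b m <= 1 by exact: kpow_01.
have tM0 : 0 <= P y x * (t / M).
  by rewrite mulr_ge0 ?trans_ge0 ?divr_ge0// ltW.
(* The correction multiplies the [m]-th term by [expR m], giving the series at [t * expR 1], at most
   [expR (t * expR 1)]; with [expR (- t)] this yields [(expR 1 - 1) * t]. *)
suff main : P y x * (t / M) * (egf a t - expR (1 - M) * egf a (t * expR 1)) <=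
    egf b t.
  have e0 : 0 < expR (- t) by exact: expR_gt0.
  rewrite -(ler_pM2l e0) in main; apply: (le_trans _ main).
  rewrite [leRHS]mulrCA ler_wpM2l// mulrBr.
  rewrite -[p t o y]/(expR (- t) * egf a t) lerD2l lerN2 mulrCA.
  have -> : 1 - M + (expR 1 - 1) * t = (1 - M) + (- t + t * expR 1) by ring.
  rewrite [leRHS]expRD ler_wpM2l ?expR_ge0// expRD ler_wpM2l ?expR_ge0//.
  by apply: egf_le_expR => //; rewrite mulr_ge0 ?expR_ge0 ?ltW.
pose S (c : R) := series (fun m => c ^+ m / m`!%:R * a m).
have hS n : P y x * (t / M) * (S t n - expR (1 - M) * S (t * expR 1) n) <= egf b t.
  apply: le_trans (egf_ge_series n.+1 (ltW t0) b01).
  (* The zeroth term of [b] is dropped, so that its term [m.+1] faces term [m] of [a]. *)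
  rewrite /series /= big_nat_recl//=.
  apply: ler_wpDl; first by rewrite !mulr_ge0 ?expr0 ?invr_ge0//; case/andP: (b01 0%N).
  rewrite /S /series /= mulr_sumr -sumrB mulr_sumr; apply: ler_sum => m _.
  have w0 : 0 <= t ^+ m / m`!%:R by rewrite divr_ge0// exprn_ge0 ?ltW.
  have [am _] := andP (a01 m).
  have hb : a m * P y x <= b m.+1.
    rewrite /b kpowSr (bigD1 y)//= lerDl; apply: sumr_ge0 => z _.
    by rewrite mulr_ge0 ?kpow_ge0 ?trans_ge0.
  apply: (@le_trans _ _ (t ^+ m.+1 / m.+1`!%:R * (a m * P y x))); last first.
    by rewrite ler_wpM2l// divr_ge0// exprn_ge0 ?ltW.
  have -> : t ^+ m.+1 / m.+1`!%:R * (a m * P y x) =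
      (t ^+ m / m`!%:R * a m * P y x * t) * (m.+1%:R)^-1.
    by rewrite factS natrM exprS invfM; ring.
  have hv := invr_ge_exp (ltr0Sn R m) M0.
  have c0 : 0 <= t ^+ m / m`!%:R * a m * P y x * t.
    by rewrite (mulr_ge0 _ (ltW t0))// (mulr_ge0 _ (trans_ge0 y x))// mulr_ge0.
  apply: le_trans (ler_wpM2l c0 hv); rewrite le_eqVlt; apply/orP; left; apply/eqP.
  have -> : m.+1%:R - M = (1 - M) + m%:R * 1 by rewrite -natr1; ring.
  rewrite [expR (1 - M + _)]expRD expRM_natl exprMn; field.
  by rewrite (gt_eqF M0) pnatr_eq0 -lt0n fact_gt0.
have cS c : S c @ \oo --> egf a c by exact: cvg_egf.
have cl : (fun n => P y x * (t / M) * (S t n - expR (1 - M) * S (t * expR 1) n)) @ \oo -->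
    P y x * (t / M) * (egf a t - expR (1 - M) * egf a (t * expR 1)).
  apply: cvgM; first exact: cvg_cst.
  apply: cvgB; first exact: cS.
  by apply: cvgM; [exact: cvg_cst|exact: cS].
rewrite -(cvg_lim _ cl)//; apply: limr_le; first exact: cvgP cl.
by apply: nearW => n; exact: hS.
Qed.

Lemma Delta_gt0 : 0 < D.
Proof. by apply: lt_le_trans (Delta_ge1 X). Qed.

(** Loops of the path are skipped, since [D] controls only off-diagonal entries; hence [j] may be
    smaller than [m]. *)
Lemma kpow_lower_bound m x y : 0 < kpow P m x y ->
  exists2 j, (j <= m)%N & D ^- j <= kpow P j x y.
Proof.
elim: m x => [|m IH] x.
  rewrite /=; case: eqVneq => [->|_]; rewrite ?ltxx// => _.
  by exists 0%N; rewrite //= expr0 invr1 eqxx.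
move=> /kpow_gt0S[z [xz /IH[j jm hj]]].
case: (eqVneq x z) => [->|xz']; first by exists j => //; exact: leqW.
exists j.+1 => //=; rewrite (bigD1 z)//=.
apply: ler_wpDr.
  by apply: sumr_ge0 => w _; rewrite mulr_ge0 ?trans_ge0 ?kpow_ge0.
rewrite exprS invfM ler_pM ?invr_ge0 ?exprn_ge0 ?(ltW Delta_gt0)//.
by rewrite -[leLHS]mul1r ler_pdivrMr ?Delta_gt0// mulrC Delta_ge.
Qed.

(** A single Poisson term [j <= B * t] is kept. Since [j! <= j^j <= (B * t)^j], its weight is at
    least [B ^- j] times [expR (- t)], and [B <= expR B]. *)
Lemma semigroup_lower_bound o y t B : 0 < t -> 1 <= B ->
  (ddist o y)%:R <= B * t ->
  expR (- ((1 + B * (B + ln D)) * t)) <= p t o y.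
Proof.
move=> t0 B1 hd; have B0 : 0 < B by apply: lt_le_trans B1.
have [j jd hj] := kpow_lower_bound (ddistP o y).
have {jd hd} jBt : j%:R <= B * t by apply: le_trans hd; rewrite ler_nat.
have L0 : 0 <= ln D by rewrite ln_ge0 ?Delta_ge1.
have e0 : - ((1 + B * (B + ln D)) * t) = - t + - (B * t * (B + ln D)) by ring.
rewrite e0 expRD ler_wpM2l ?expR_ge0//.
apply: le_trans (egf_ge_series j.+1 (ltW t0) (fun m => kpow_01 m o y)).
rewrite /series /= big_nat_recr//= ler_wpDl//.
  apply: sumr_ge0 => m _.
  by rewrite mulr_ge0 ?kpow_ge0// divr_ge0 ?exprn_ge0 ?(ltW t0).
apply: (@le_trans _ _ (B ^- j * D ^- j)).
  apply: (@le_trans _ _ (expR (- (j%:R * (B + ln D))))).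
    by rewrite ler_expR lerN2 ler_wpM2r// addr_ge0// ltW.
  rewrite mulrDr opprD expRD !expRN !expRM_natl lnK ?posrE ?Delta_gt0//.
  rewrite ler_wpM2r ?invr_ge0 ?exprn_ge0 ?(ltW Delta_gt0)//.
  rewrite lef_pV2 ?posrE ?exprn_gt0 ?expR_gt0// lerXn2r ?nnegrE ?expR_ge0 ?(ltW B0)//.
  by apply: le_trans (expR_ge1Dx B); rewrite lerDr.
apply: ler_pM => //; rewrite ?invr_ge0 ?exprn_ge0 ?(ltW B0) ?(ltW Delta_gt0)//.
have hfact : j`!%:R <= (B * t) ^+ j.
  apply: (@le_trans _ _ (j%:R ^+ j)); last first.
    by rewrite lerXn2r ?nnegrE ?mulr_ge0 ?(ltW B0) ?(ltW t0).
  rewrite -natrX ler_nat fact_prod -[X in (_ <= _ ^ X)%N](subn1 j.+1).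
  rewrite -prod_nat_const_nat big_nat [leqRHS]big_nat.
  by apply: leq_prod => i /andP[].
rewrite ler_pdivlMr ?ltr0n ?fact_gt0// ler_pdivrMl ?exprn_gt0//.
by rewrite -exprMn.
Qed.

Lemma semigroup_edge_le o t B : 1 <= t -> 1 <= B ->
  (forall y, (ddist o y)%:R <= B * t) ->
  forall x y, x != y -> 0 < P y x ->
  p t o y <= 14 * B ^+ 2 * (1 + ln D) * D * p t o x.
Proof.
move=> t1 B1 hd x y xy Pyx.
have t0 : 0 < t by apply: lt_le_trans t1.
have L0 : 0 <= ln D by rewrite ln_ge0 ?Delta_ge1.
set l := ln D in L0 *.
(* With [t >= 1], this [M] dominates [2 + (expR 1 - 1) * t + (1 + B * (B + l)) * t], so the error in
   [semigroup_step] is at most half of [p t o y]; doubling 7 gives 14. *)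
pose M := 7 * B ^+ 2 * (1 + l) * t.
have M0 : 0 < M by rewrite !mulr_gt0 ?exprn_gt0 ?ltr_wpDr// (lt_le_trans _ B1).
have lb := semigroup_lower_bound t0 B1 (hd y).
have half : expR (1 - M + (expR 1 - 1) * t) <= p t o y / 2.
  apply: (@le_trans _ _ (expR (- ((1 + B * (B + l)) * t)) * expR (- 1))).
    rewrite -expRD ler_expR.
    have he : (expR 1 - 1) * t <= 3 * t.
      by rewrite ler_wpM2r ?(ltW t0)//; have := expR1_le4; lra.
    have hM : (6 + B * (B + l)) * t <= M.
      rewrite /M ler_wpM2r ?(ltW t0)//.
      have : 0 <= (B - 1) * (B * l) by rewrite !mulr_ge0 ?subr_ge0//; lra.
      have : 0 <= (B - 1) * (B + 1) by rewrite !mulr_ge0 ?subr_ge0//; lra.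
      have : 0 <= B ^+ 2 * l by rewrite mulr_ge0 ?sqr_ge0.
      rewrite expr2; nra.
    nra.
  rewrite [expR (- 1)]expRN ler_pM ?expR_ge0 ?invr_ge0 ?expR_ge0// lef_pV2 ?posrE ?expR_gt0//.
  by apply: le_trans (expR_ge1Dx 1).
have := semigroup_step o x y t0 M0; move=> step.
have h2 : P y x * (t / M) * (p t o y / 2) <= p t o x.
  apply: le_trans step; apply: ler_wpM2l; last lra.
  by rewrite mulr_ge0 ?trans_ge0 ?divr_ge0// ltW.
have tM : t / M = (7 * B ^+ 2 * (1 + l))^-1.
  by rewrite /M; field; rewrite !gt_eqF// ?ltr_wpDr// (lt_le_trans _ B1).
have c0 : 0 < 14 * B ^+ 2 * (1 + l).
  by rewrite !mulr_gt0 ?exprn_gt0 ?ltr_wpDr// (lt_le_trans _ B1).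
have h3 : P y x * p t o y <= 14 * B ^+ 2 * (1 + l) * p t o x.
  rewrite mulrC -ler_pdivrMl//; apply: le_trans h2; rewrite tM.
  rewrite le_eqVlt; apply/orP; left; apply/eqP; field.
  by rewrite !gt_eqF// ?ltr_wpDr// (lt_le_trans _ B1).
apply: (@le_trans _ _ (D * (P y x * p t o y))).
  rewrite mulrA -[leLHS]mul1r ler_wpM2r ?semigroup_ge0 ?(ltW t0)//.
  by rewrite Delta_ge// eq_sym.
by rewrite mulrAC [leRHS]mulrC ler_pM2l ?Delta_gt0.
Qed.

Lemma stat_edge_le x y : x != y -> 0 < P x y -> pi x <= D * pi y.
Proof.
move=> xy Pxy; apply: (@le_trans _ _ (D * (pi x * P x y))).
  by rewrite mulrCA ler_peMr ?stat_ge0// Delta_ge.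
rewrite ler_pM2l ?Delta_gt0// -(stat_invariant y) (bigD1 x)//= lerDl.
by apply: sumr_ge0 => z _; rewrite mulr_ge0 ?stat_ge0 ?trans_ge0.
Qed.

(** Along an edge [ln p] and [ln pi] are bounded on the same side, so their difference needs one
    bound reversed, which costs the factor [k]. *)
Lemma log_density_lipschitz o t B : 1 <= t -> 1 <= B ->
  (forall y, (ddist o y)%:R <= B * t) ->
  forall x y, x != y -> 0 < P x y ->
  `|ln (p t o x / pi x) - ln (p t o y / pi y)| <=
    k%:R * (14 + 2 * B + 3 * ln D).
Proof.
move=> t1 B1 hd x y xy Pxy.
have t0 : 0 < t by apply: lt_le_trans t1.
have B0 : 0 < B by apply: lt_le_trans B1.
have L0 : 0 <= ln D by rewrite ln_ge0 ?Delta_ge1.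
have k1 := kmax_ge1 X.
have p0 z : 0 < p t o z.
  by apply: lt_le_trans (semigroup_lower_bound t0 B1 (hd z)); exact: expR_gt0.
have pi0 := @stat_gt0 R X.
have hpi u v : u != v -> 0 < P u v -> ln (pi u) - ln (pi v) <= ln D.
  move=> uv Puv; rewrite lerBlDr -lnM ?posrE ?Delta_gt0// ler_ln ?posrE//.
    exact: stat_edge_le.
  by rewrite mulr_gt0 ?Delta_gt0.
have hp u v : u != v -> 0 < P u v ->
    ln (p t o u) - ln (p t o v) <= 14 + 2 * B + 2 * ln D.
  move=> uv Puv.
  have c0 : 0 < 14 * B ^+ 2 * (1 + ln D).
    by rewrite !mulr_gt0 ?exprn_gt0 ?ltr_wpDr.
  have cD : 0 < 14 * B ^+ 2 * (1 + ln D) * D by rewrite mulr_gt0 ?Delta_gt0.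
  apply: (@le_trans _ _ (ln (14 * B ^+ 2 * (1 + ln D) * D))).
    rewrite lerBlDr -lnM ?posrE// ler_ln ?posrE ?(mulr_gt0 cD (p0 v))//.
    by apply: semigroup_edge_le => //; rewrite eq_sym.
  have B20 : 0 < B ^+ 2 by rewrite exprn_gt0.
  have l0 : 0 < 1 + ln D by rewrite ltr_wpDr.
  have -> : ln (14 * B ^+ 2 * (1 + ln D) * D) =
      ln 14 + ln (B ^+ 2) + ln (1 + ln D) + ln D.
    by rewrite -!lnM ?posrE ?mulr_gt0 ?Delta_gt0.
  have h1 : ln 14 <= 14 :> R by rewrite ltW// ln_sublinear.
  have h2 : ln (B ^+ 2) <= 2 * B.
    by rewrite lnXn//; have := ln_sublinear B0; lra.
  have h3 : ln (1 + ln D) <= ln D by apply: le_ln1Dx; apply: lt_le_trans L0.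
  lra.
have a0 : 0 <= 14 + 2 * B + 2 * ln D by lra.
have hp' := lipschitz_rev_edge a0 hp Pxy.
have hpi' := lipschitz_rev_edge L0 hpi Pxy.
have {}hp := hp _ _ xy Pxy; have {}hpi := hpi _ _ xy Pxy.
rewrite !ln_div ?posrE// ler_norml; apply/andP; split; nra.
Qed.

End LogGradient.

(** * Cutoff *)

Section KeyEstimate.
Variables (R : realType) (X : markov_chain R).
Local Notation P := (@trans R X).
Local Notation pi := (@stat R X).
Local Notation p := (@semigroup R X).
Local Notation k := (kmax X).
Local Notation D := (Delta X).
Implicit Types (f g h : X -> R) (x y z o : X) (s t eps B M : R).

(* [r] is the scale of the square root of the varentropy: by Chebyshev [g], the
   logarithm of the density, is within [r] of its mean outside mass [eps / 2],
   and that mean is at most [r + 2 / eps] because [mu] and [pi] overlap. *)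
Lemma tv_dist_semigroup_window mu g eps r s :
  (forall x, 0 <= mu x) -> \sum_x mu x = 1 ->
  (forall x, mu x = expR (g x) * pi x) ->
  0 < eps -> 0 < r ->
  tv_dist mu pi <= 1 - eps ->
  \sum_x mu x * g x ^+ 2 - (\sum_x mu x * g x) ^+ 2 <= r ^+ 2 * (eps / 2) ->
  trel X * (r + 2 / eps) <= s ->
  tv_dist (fun y => \sum_x mu x * p s x y) pi <= eps.
Proof.
move=> mu0 mu1 muE e0 r0 htv.
have [H HE] : exists H, H = \sum_x mu x * g x by eexists.
rewrite -HE => hV hs.
have T0 := trel_gt0 X.
have ei : 0 < 2 / eps by rewrite divr_gt0.
pose A := [pred x | `|g x - H| <= r].
have muA : \sum_(x | ~~ A x) mu x <= eps / 2.
  have r20 : 0 < r ^+ 2 by rewrite exprn_gt0.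
  rewrite -(ler_pM2l r20); apply: le_trans hV.
  have -> : \sum_x mu x * g x ^+ 2 - H ^+ 2 = \sum_x mu x * (g x - H) ^+ 2.
    have -> : H ^+ 2 = 2 * H * (\sum_x mu x * g x) - H ^+ 2 * \sum_x mu x.
      by rewrite mu1 -HE; ring.
    rewrite mulr_sumr [X in _ - (_ - X)]mulr_sumr -!sumrB; apply: eq_bigr => x _; ring.
  rewrite [leRHS](bigID A)/= ler_wpDl//.
    by apply: sumr_ge0 => x _; rewrite mulr_ge0 ?sqr_ge0.
  rewrite mulr_sumr; apply: ler_sum => x; rewrite -ltNge => /ltW h.
  rewrite mulrC ler_wpM2l// -[leRHS]real_normK ?num_real//.
  by rewrite lerXn2r ?nnegrE// ltW.
have piA : eps / 2 <= expR (r - H).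
  have h1 := tv_dist_ge A mu1.
  have h2 : \sum_(x | A x) pi x <= expR (r - H).
    apply: (@le_trans _ _ (\sum_(x | A x) expR (r - H) * mu x)).
      apply: ler_sum => x; rewrite /A /= ler_norml => /andP[hx _].
      rewrite muE mulrA -expRD ler_peMl ?stat_ge0// -expR0 ler_expR; lra.
    rewrite -mulr_sumr ler_piMr ?expR_ge0// -mu1 [leRHS](bigID A)/= lerDl.
    exact: sumr_ge0.
  move: mu1; rewrite (bigID A)/=; lra.
have hH : H - r <= 2 / eps.
  (* The logarithm of [2 / eps] is replaced by the larger [2 / eps] itself. *)
  rewrite -ler_expR; apply: le_trans (_ : 2 / eps <= _); last first.
    by apply: le_trans (expR_ge1Dx _); rewrite lerDr.
  rewrite -[H - r]opprB expRN -[2 / eps]invf_div lef_pV2 ?posrE ?expR_gt0//.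
  by rewrite divr_gt0.
apply: (@tv_dist_semigroup_le _ _ A _ _ (2 * r + 2 / eps)) => //.
- move=> x; rewrite /A /= ler_norml => /andP[_ hx].
  rewrite muE ler_wpM2r ?stat_ge0// ler_expR; lra.
- by apply: le_trans hs; rewrite mulr_ge0 ?addr_ge0 ?ltW.
(* The lower bound on [s] cancels [2 * r] and leaves [- 2 / eps], enough because
   [expR (- eps^-1) <= eps]. *)
- have h : 2 * r + 2 / eps - 2 * s / trel X <= - (2%:R * eps^-1).
    have : trel X * (r + 2 / eps) / trel X <= s / trel X.
      by rewrite ler_wpM2r// invr_ge0 ltW.
    rewrite mulrAC divff ?gt_eqF// mul1r -[2 * s / _]mulrA; lra.
  apply: (@le_trans _ _ (expR (- (2%:R * eps^-1)))); first by rewrite ler_expR.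
  rewrite expRN expRM_natl -[leRHS]invrK lef_pV2 ?posrE ?invr_gt0 ?exprn_gt0 ?expR_gt0//.
  rewrite -exprVn lerXn2r ?nnegrE ?invr_ge0 ?expR_ge0 ?(ltW e0)//.
  by apply: le_trans (expR_ge1Dx _); rewrite lerDr.
Qed.

Definition cutoff_quantity : R := k%:R ^+ 2 * (1 + ln D) * trel X.

Lemma trel_le_quantity : k%:R ^+ 2 * trel X <= cutoff_quantity.
Proof.
rewrite /cutoff_quantity ler_wpM2r ?(ltW (trel_gt0 X))//.
by rewrite ler_peMr ?sqr_ge0// lerDl ln_ge0 ?Delta_ge1.
Qed.

Lemma quantity_ge : 2^-1 <= cutoff_quantity.
Proof.
apply: le_trans trel_le_quantity; apply: le_trans (trel_ge X) _.
by rewrite ler_peMl ?(ltW (trel_gt0 X))// expr_ge1 ?kmax_ge1.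
Qed.

Lemma worst_tv_window t eps : BE_inequality X 0 -> 0 < eps < 1 -> 1 <= t ->
  worst_tv X t <= 1 - eps -> cutoff_quantity ^+ 2 <= t ->
  worst_tv X (t + 68 / eps ^+ 2 * cutoff_quantity * Num.sqrt t) <= eps.
Proof.
move=> BE0 /andP[e0 e1] t1 htv hq.
have t0 : 0 < t by apply: lt_le_trans t1.
have q2 := quantity_ge.
have k1 : 1 <= k%:R :> R := kmax_ge1 X.
have L1 : 1 <= 1 + ln D by rewrite lerDl ln_ge0 ?Delta_ge1.
have T0 := trel_gt0 X.
have [e eE] : exists e, e = eps^-1 by eexists.
have ge1 : 1 <= e by rewrite eE invf_ge1// ltW.
have st1 : 1 <= Num.sqrt t by rewrite -sqrtr1 ler_wsqrtr.
(* [diameter_le] is used with [r = 2 * t * e], which gives [2 k (2 t e + 2 t e)]. *)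
have diam x y : (ddist x y)%:R <= (8 * k%:R * e) * t.
  have hr : k%:R ^+ 2 * trel X <= eps * (2 * t * e) ^+ 2.
    have -> : eps * (2 * t * e) ^+ 2 = 4 * t ^+ 2 * e.
      by rewrite eE; field; rewrite gt_eqF.
    apply: le_trans trel_le_quantity _.
    apply: (@le_trans _ _ (4 * t)).
      (* From [q >= 1/2] follows [q <= 2 q^2 <= 2 t]. *)
      have : 0 <= (cutoff_quantity - 2^-1) * cutoff_quantity.
        by rewrite mulr_ge0 ?subr_ge0//; lra.
      rewrite expr2 in hq; lra.
    rewrite -mulrA ler_pM2l// expr2 -mulrA ler_peMr ?(ltW t0)//.
    by rewrite mulr_ege1.
  have r0 : 0 <= 2 * t * e by rewrite !mulr_ge0 ?(ltW t0)//; lra.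
  have := diameter_le t0 e0 htv (ltW e1) r0 hr x y.
  by rewrite -[2 * t / eps]/(2 * t * eps^-1) -eE; lra.
have B1 : 1 <= 8 * k%:R * e.
  have : 1 <= k%:R * e by rewrite mulr_ege1.
  by rewrite -mulrA; lra.
(* [K] bounds the log-gradient for [B = 8 k e]; here 33 = 14 + 2 * 8 + 3. *)
have [K KE] : exists K, K = 33 * e * k%:R ^+ 2 * (1 + ln D) by eexists.
have K0 : 0 < K.
  by rewrite KE !mulr_gt0 ?exprn_gt0//; lra.
have grad o x y : x != y -> 0 < P x y ->
    `|ln (p t o x / pi x) - ln (p t o y / pi y)| <= K.
  move=> xy Pxy; apply: le_trans (log_density_lipschitz t1 B1 (diam o) xy Pxy) _.
  have -> : K = k%:R * (33 * (e * k%:R * (1 + ln D))) by rewrite KE; ring.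
  rewrite ler_wpM2l//.
  have ek : 1 <= e * k%:R by rewrite mulr_ege1.
  have h1 : 1 <= e * k%:R * (1 + ln D) by rewrite mulr_ege1.
  have h2 : k%:R * e <= e * k%:R * (1 + ln D).
    by rewrite [k%:R * e]mulrC ler_peMr//; lra.
  have h3 : ln D <= e * k%:R * (1 + ln D).
    by apply: (@le_trans _ _ (1 + ln D)); [lra|rewrite ler_peMl//; lra].
  lra.
have e0' : 0 <= 1 - eps by rewrite subr_ge0 ltW.
apply/worst_tv_leP => [|o]; first exact: ltW.
have -> : p (t + 68 / eps ^+ 2 * cutoff_quantity * Num.sqrt t) o =
    fun y => \sum_x p t o x * p (68 / eps ^+ 2 * cutoff_quantity * Num.sqrt t) x y.
  by apply/funext => y; rewrite semigroupD.
have p0 y : 0 < p t o y.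
  by apply: lt_le_trans (semigroup_lower_bound t0 B1 (diam o y)); exact: expR_gt0.
have [g gE] : exists g : X -> R, g = fun x => ln (p t o x / pi x) by eexists.
(* The local Poincare inequality bounds the varentropy by [t * K ^+ 2], while this scale allows
   [2 * t * K ^+ 2 * e]. *)
apply: (@tv_dist_semigroup_window _ g _ (2 * e * Num.sqrt t * K)) => //.
- by move=> x; exact: ltW.
- exact: semigroup_sum1.
- by move=> x; rewrite gE lnK ?posrE ?divr_gt0 ?stat_gt0// divfK// gt_eqF// stat_gt0.
- by rewrite !mulr_gt0//; lra.
- by move/worst_tv_leP: htv => /(_ e0' o).
- apply: le_trans (local_poincare BE0 g o (ltW t0)) _.
  have hG : \sum_y p t o y * Gamma g g y <= K ^+ 2 / 2.
    have -> : K ^+ 2 / 2 = \sum_y p t o y * (K ^+ 2 / 2).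
      by rewrite -mulr_suml semigroup_sum1 mul1r.
    apply: ler_sum => y _; rewrite ler_wpM2l ?(ltW (p0 y))//.
    apply: Gamma_le => [|z yz Pyz]; first exact: ltW.
    by rewrite gE; exact: grad.
  have -> : (2 * e * Num.sqrt t * K) ^+ 2 * (eps / 2) = 2 * t * (K ^+ 2 * e).
    rewrite !exprMn sqr_sqrtr ?(ltW t0)// eE; field.
    by rewrite gt_eqF.
  rewrite ler_pM2l ?mulr_gt0//; apply: le_trans hG _.
  rewrite ler_pM2l ?exprn_gt0//; lra.
(* The scale term costs 66 = 2 * 33; the remaining 2 pays for [trel X * (2 / eps)]. *)
- have -> : 68 / eps ^+ 2 = 68 * e ^+ 2 by rewrite eE exprVn.
  rewrite -[2 / eps]/(2 * eps^-1) -eE mulrDr.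
  have -> : trel X * (2 * e * Num.sqrt t * K) =
      66 * e ^+ 2 * cutoff_quantity * Num.sqrt t.
    by rewrite KE /cutoff_quantity; ring.
  have hTq : trel X <= cutoff_quantity.
    apply: le_trans trel_le_quantity.
    by rewrite ler_peMl ?(ltW T0)// expr_ge1.
  have : trel X * e <= cutoff_quantity * (e ^+ 2 * Num.sqrt t).
    rewrite ler_pM// ?(ltW T0)//; first lra.
    rewrite expr2 -mulrA ler_peMr//; first lra.
    by rewrite mulr_ege1.
  lra.
Qed.

End KeyEstimate.

(** * Mixing times as infima, and the cutoff window *)

Section MixingTime.
Variables (R : realType) (X : markov_chain R).
Implicit Types (t eps : R).

Lemma tmix_has_inf eps : 0 < eps -> has_inf [set t | 0 <= t /\ worst_tv X t <= eps].
Proof.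
move=> e0; split; last by exists 0 => t [].
by have [t t0 ht] := mixing_time_exists X e0; exists t.
Qed.

Lemma tmix_le t eps : 0 <= t -> worst_tv X t <= eps -> tmix X eps <= t.
Proof. by move=> t0 ht; apply: ge_inf => //; exists 0 => u []. Qed.

Lemma tmix_antitone eps eps' : 0 < eps -> eps <= eps' -> tmix X eps' <= tmix X eps.
Proof.
move=> e0 ee'; have [ne _] := tmix_has_inf e0.
apply: lb_le_inf => // t [t0 ht]; apply: tmix_le => //; exact: le_trans ee'.
Qed.

(** [worst_tv_window] is applied at a time [t] in [[tau, tau + 1)] approaching the infimum: this
    adds 1, and [sqrt t <= 2 sqrt tau] doubles 68. *)
Lemma tmix_window eps : BE_inequality X 0 -> 0 < eps < 1 ->
  let tau := tmix X (1 - eps) in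
  1 <= tau -> cutoff_quantity X ^+ 2 <= tau ->
  tmix X eps <= tau + 1 + 136 / eps ^+ 2 * cutoff_quantity X * Num.sqrt tau.
Proof.
move=> BE0 e01; have [e0 e1] := andP e01.
move=> tau tau1 hq.
have e1' : 0 < 1 - eps by rewrite subr_gt0.
have [t [t0 htv] tlt] := inf_adherent ltr01 (tmix_has_inf e1').
have taut : tau <= t by exact: tmix_le.
have t1 : 1 <= t by apply: le_trans taut.
have q0 : 0 < cutoff_quantity X by apply: lt_le_trans (quantity_ge X).
have c0 : 0 <= 68 / eps ^+ 2 * cutoff_quantity X.
  by rewrite mulr_ge0 ?(ltW q0)// divr_ge0 ?exprn_ge0 ?(ltW e0).
have hw := worst_tv_window BE0 e01 t1 htv (le_trans hq taut).
apply: le_trans (tmix_le _ hw) _; first exact: addr_ge0 (mulr_ge0 c0 (sqrtr_ge0 _)).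
apply: lerD; first exact: ltW.
have -> : 136 / eps ^+ 2 * cutoff_quantity X * Num.sqrt tau =
    68 / eps ^+ 2 * cutoff_quantity X * (2 * Num.sqrt tau) by ring.
rewrite ler_wpM2l//.
have -> : 2 * Num.sqrt tau = Num.sqrt (2 ^+ 2 * tau).
  by rewrite sqrtrM ?sqrtr_sqr ?ger0_norm.
rewrite ler_wsqrtr//; have : t < tau + 1 by exact: tlt.
rewrite expr2; lra.
Qed.

End MixingTime.

(** * Limit of the ratio of mixing times *)

Section Asymptotics.
Variables (R : realType) (X : nat -> markov_chain R).
Hypothesis BE_ge0 : forall n : nat, (1 <= n)%N -> (0%E <= BE (X n))%E.
Hypothesis prod_cond : forall eps : R, 0 < eps < 2^-1 ->
  equot (cutoff_quantity (X n)) (Num.sqrt (tmix (X n) (1 - eps)))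
    @[n --> \oo] --> 0%E.
Implicit Types (eps d : R).

Lemma equotE (a b : R) : b != 0 -> equot a b = (a / b)%:E.
Proof. by move=> b0; rewrite /equot inver (negbTE b0) -EFinM. Qed.

Lemma quantity_le_near eps d : 0 < eps < 2^-1 -> 0 < d ->
  \forall n \near \oo, 0 < tmix (X n) (1 - eps) /\
    cutoff_quantity (X n) <= d * Num.sqrt (tmix (X n) (1 - eps)).
Proof.
move=> he d0.
have hN : nbhs (0%E : \bar R) [set y | (y < d%:E)%E].
  by apply: open_nbhs_nbhs; split; [exact: open_ereal_lt_ereal|rewrite /= lte_fin].
have : \forall n \near \oo, (equot (cutoff_quantity (X n))
    (Num.sqrt (tmix (X n) (1 - eps))) < d%:E)%E by exact: (prod_cond he hN).
apply: filterS => n; set s := Num.sqrt _ => hs.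
have q0 : 0 < cutoff_quantity (X n) by apply: lt_le_trans (quantity_ge (X n)).
(* A zero denominator would make the quotient [+oo], against [hs]. *)
have s0 : s != 0.
  apply/eqP => s0; move: hs; rewrite s0 /equot inver eqxx.
  by rewrite gt0_muley ?lte_fin//.
have s1 : 0 < s by rewrite lt0r s0 sqrtr_ge0.
split; first by move: s1; rewrite /s sqrtr_gt0.
by move: hs; rewrite (equotE _ s0) lte_fin ltr_pdivrMr// => /ltW.
Qed.

Lemma cvg_tmix_ratio eps : 0 < eps < 2^-1 ->
  tmix (X n) eps / tmix (X n) (1 - eps) @[n --> \oo] --> (1 : R).
Proof.
move=> he; have [e0 e2] := andP he.
have e01 : 0 < eps < 1 by rewrite e0/=; apply: lt_trans e2 _; lra.
apply/cvgrPdist_le => eta eta0.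
have [C CE] : exists C, C = 136 / eps ^+ 2 by eexists.
have C0 : 0 <= C by rewrite CE divr_ge0// exprn_ge0// ltW.
(* The bound 1/2 yields [s >= 1] and [q ^+ 2 <= tau]; the other makes the relative error at most
   [eta]. *)
pose d := Num.min (2^-1) (eta / (4 + C)).
have d0 : 0 < d by rewrite lt_min invr_gt0 ltr0Sn divr_gt0// ltr_wpDr.
have d2 : d <= 2^-1 by rewrite ge_min lexx.
have dC : (4 + C) * d <= eta.
  by rewrite -ler_pdivlMl ?ltr_wpDr// mulrC ge_min lexx orbT.
near=> n.
have [tau0 hq] : 0 < tmix (X n) (1 - eps) /\
    cutoff_quantity (X n) <= d * Num.sqrt (tmix (X n) (1 - eps)).
  by near: n; exact: quantity_le_near.
have n1 : (1 <= n)%N by near: n; exact: nbhs_infty_ge.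
have BE0 := BE_inequality0 (BE_ge0 n1).
set q := cutoff_quantity (X n) in hq.
have q2 : 2^-1 <= q := quantity_ge (X n).
pose tau := tmix (X n) (1 - eps).
have [s sE] : exists s, s = Num.sqrt tau by eexists.
rewrite -/tau -sE in hq tau0 *.
have s2 : s ^+ 2 = tau by rewrite sE sqr_sqrtr// ltW.
have s0 : 0 <= s by rewrite sE sqrtr_ge0.
have ds : 2^-1 <= d * s by apply: le_trans hq.
have s1 : 1 <= s.
  by have : d * s <= 2^-1 * s by [rewrite ler_wpM2r]; lra.
have tau1 : 1 <= tau by rewrite -s2 expr_ge1.
have qq : q ^+ 2 <= tau.
  rewrite -s2 lerXn2r ?nnegrE//; first lra.
  by apply: le_trans hq _; rewrite ler_piMl//; lra.
have := tmix_window BE0 e01 tau1 qq; rewrite -/tau -sE -/q -CE => hwin.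
have hmono : tau <= tmix (X n) eps by apply: tmix_antitone => //; lra.
rewrite distrC ger0_norm; last by rewrite subr_ge0 ler_pdivlMr// mul1r.
rewrite lerBlDr ler_pdivrMr// mulrDl mul1r addrC.
apply: le_trans hwin _; rewrite -addrA lerD2l.
apply: (@le_trans _ _ ((4 + C) * d * tau)); last by rewrite ler_wpM2r// ltW.
(* The additive 1 of the window is absorbed through [1/2 <= q <= d * s]; this is the 4 in
   [4 + C]. *)
have h1 : 1 <= 4 * d * tau.
  have : 2^-1 * 2^-1 <= (d * s) * (d * s) by rewrite ler_pM ?invr_ge0.
  have : (d * s) * (d * s) <= d * tau.
    have -> : (d * s) * (d * s) = d * (d * tau) by rewrite -s2; ring.
    by rewrite ler_piMl ?mulr_ge0 ?(ltW d0) ?(ltW tau0)//; lra.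
  lra.
have h2 : C * q * s <= C * d * tau.
  have -> : C * d * tau = C * (d * s) * s by rewrite -s2; ring.
  by rewrite ler_wpM2r// ler_wpM2l.
lra.
Unshelve. all: by end_near. Qed.

(** Above 1/2 the ratio is the inverse of the one at [1 - eps]; at 1/2 it is eventually constant.
    Eventual positivity of the denominators passes from real to extended quotients. *)
Lemma cutoff_of_product_condition : cutoff X.
Proof.
have pos eps : 0 < eps < 2^-1 -> \forall n \near \oo, 0 < tmix (X n) (1 - eps).
  by move=> he; apply: filterS (quantity_le_near he ltr01) => n [].
have conv (a b : nat -> R) : (\forall n \near \oo, 0 < b n) ->
    a n / b n @[n --> \oo] --> (1 : R) ->
    equot (a n) (b n) @[n --> \oo] --> 1%E.
  move=> hb hab; apply: cvg_EFin.
    by apply: filterS hb => n bn; rewrite equotE ?gt_eqF.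
  apply: cvg_trans hab; apply: near_eq_cvg.
  by apply: filterS hb => n bn; rewrite /= equotE ?gt_eqF.
move=> eps /andP[e0 e1]; case: (ltgtP eps 2^-1) => he.
- have h : 0 < eps < 2^-1 by rewrite e0.
  by apply: conv; [exact: pos|exact: cvg_tmix_ratio].
- have h : 0 < 1 - eps < 2^-1 by apply/andP; split; lra.
  have hE : 1 - (1 - eps) = eps by ring.
  have hp : \forall n \near \oo, 0 < tmix (X n) (1 - eps).
    apply: filterS (pos _ h) => n; rewrite hE => /lt_le_trans; apply.
    by apply: tmix_antitone; lra.
  apply: conv => //.
  have hV : (tmix (X n) (1 - eps) / tmix (X n) (1 - (1 - eps)))^-1
    @[n --> \oo] --> (1^-1 : R).
    by apply: cvgV; [exact: oner_neq0|exact: cvg_tmix_ratio].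
  rewrite hE invr1 in hV; apply: cvg_trans hV; apply: near_eq_cvg.
  by apply: nearW => n; rewrite /= invf_div.
- have -> : 1 - eps = eps by rewrite he; lra.
  (* Positivity at level 1/2 is inherited from level 3/4 by monotonicity. *)
  have hp : \forall n \near \oo, 0 < tmix (X n) eps.
    have h : 0 < (4^-1 : R) < 2^-1 by apply/andP; split; lra.
    apply: filterS (pos _ h) => n => /lt_le_trans; apply.
    by apply: tmix_antitone => //; rewrite he; lra.
  apply: conv => //; apply: cvg_near_cst.
  by apply: filterS hp => n hn; rewrite divff ?gt_eqF.
Qed.

End Asymptotics.

Theorem theorem1p2 (R : realType) (X : nat -> markov_chain R)
  (BE_ge0 : forall n : nat, (1 <= n)%N -> (0%E <= BE (X n))%E)
  (prod_cond : forall eps : R, 0 < eps < 2^-1 ->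
     equot ((kmax (X n))%:R ^+ 2 * (1 + ln (Delta (X n))) * trel (X n))
           (Num.sqrt (tmix (X n) (1 - eps))) @[n --> \oo] --> 0%E) :
  cutoff X.
Proof. exact: cutoff_of_product_condition BE_ge0 prod_cond. Qed.
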